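(* Let $U\subseteq\mathbb{R}^m$ be a nonempty open set with finite Lebesgue measure $\mu(U)<\infty$, and let $K$ be a bounded integral operator on the real Hilbert space $L^2(U)$, $Kf(t)=\int_U K(t,s)f(s)\,\mathrm{d}s$, whose kernel $K:U\times U\to\mathbb{R}$ is uniformly continuous. Then the associated Gaussian process $\tilde K$ is locally continuous in every $t_0\in U$, and for all $u_1,u_2\in U$, $$\mathrm{Cov}(\tilde K(u_1),\tilde K(u_2))=\int_U K(u_1,t)K(u_2,t)\,\mathrm{d}t.$$
   Context: $B(x,\epsilon)$ is the ball around $x$ of radius $\epsilon$ ($\epsilon$ small enough that it lies in $U$). For a bounded operator $O$ on $L^2(U)$, an orthonormal basis $(e_i)_{i\ge1}$ of $L^2(U)$ and i.i.d. $N(0,1)$ random variables $(X_i)_{i\ge1}$ on a probability space $(\Omega,\mathbb{F},P)$, the associated Gaussian process is $\tilde O(f)=\sum_{i=1}^\infty X_i\langle f,Oe_i\rangle$, $f\in L^2(U)$ (for each fixed $f$ the series converges almost surely). For a Borel set $A\subseteq U$ of finite measure, $\tilde O(A):=\tilde O(1_A)$. The process $\tilde O$ is called locally continuous in $x\in U$ if the random variables $\tilde O(B(x,\epsilon))/\mu(B(x,\epsilon))$ converge in $L^2(\Omega,P)$ as $\epsilon\to0$; the limit is then denoted $\tilde O(x)$. *)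

(* Defs.v *)
From HB Require Import structures.
From mathcomp Require Import all_boot all_order all_algebra.
From mathcomp Require Import all_classical all_reals all_analysis.
From mathcomp Require Import measurable_realfun.

Set Implicit Arguments.
Unset Strict Implicit.
Unset Printing Implicit Defensive.
Import Order.TTheory GRing.Theory Num.Theory.
Import numFieldNormedType.Exports.

Local Open Scope classical_set_scope.
Local Open Scope ring_scope.

(* R^m is 'rV[R]_m.  The library puts a topology (that of the max norm) on
   matrices, but no sigma-algebra and no Lebesgue measure: the Borel
   sigma-algebra and Lebesgue measure are built first. *)

HB.instance Definition _ (R : realType) (m n : nat) :=
  @isMeasurable.Build (sigma_display (@open 'M[R]_(m, n))) 'M[R]_(m, n)
    <<s @open 'M[R]_(m, n) >> (@sigma_algebra0 _ setT _) (@sigma_algebraC _ _)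
    (@sigma_algebra_bigcup _ setT _).

Section borel_mx.
Context (R : realType).

Lemma open_measurable_mx m n (A : set 'M[R]_(m, n)) : open A -> measurable A.
Proof. by move=> oA; apply: sub_sigma_algebra. Qed.

Lemma measurable_coord_mx m n i j :
  measurable_fun setT (fun x : 'M[R]_(m, n) => x i j).
Proof.
apply: (measurability _ (RGenOInfty.measurableE R)).
move=> _ [_ [a ->] <-]; rewrite setTI.
apply: open_measurable_mx; apply: open_comp; last exact: interval_open.
by move=> x _; exact: coord_continuous.
Qed.

Lemma open_mx_countable_cubes m n (A : set 'M[R]_(m, n)) : open A ->
  A = \bigcup_(q in [set q : 'M[rat]_(m, n) * rat | 0 < (ratr q.2 : R) /\
        ball (map_mx ratr q.1 : 'M[R]_(m, n)) (ratr q.2) `<=` A])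
      ball (map_mx ratr q.1 : 'M[R]_(m, n)) (ratr q.2).
Proof.
move=> oA; apply/seteqP; split => [x Ax|x [q [q0 qA] qx]]; last exact: qA.
have [e /= e0 eA] : exists2 e : R, 0 < e & ball x e `<=` A.
  by apply/nbhs_ballP; exact: open_nbhs_nbhs.
have e20 : 0 < e / 2 by rewrite divr_gt0.
have /rat_in_itvoo[r] := e20; rewrite in_itv /= => /andP[r0 re].
have cq i j : exists q : rat, `|x i j - ratr q| < ratr r.
  have /rat_in_itvoo[q] : x i j - ratr r < x i j + ratr r.
    by rewrite ltrBlDr -addrA ltrDl addr_gt0.
  by rewrite in_itv /= => ?; exists q; rewrite distrC ltr_distl.
pose Q := \matrix_(i, j) xget 0 [set q : rat | `|x i j - ratr q| < ratr r].
have QP i j : `|x i j - ratr (Q i j)| < ratr r.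
  by rewrite mxE; exact: (xgetPex 0 (cq i j)).
have xQ : ball (map_mx ratr Q : 'M[R]_(m, n)) (ratr r) x.
  by split => // i j; rewrite mxE /ball /= distrC.
exists (Q, r) => //=; split => // y Qy; apply: eA.
apply: (@le_ball _ _ _ (ratr r + ratr r)).
  by rewrite (splitr e) lerD// ltW.
by apply: ball_triangle Qy; exact: ball_sym.
Qed.

Lemma measurable_fun_mx d (T : measurableType d) m n (f : T -> 'M[R]_(m, n)) :
  (forall i j, measurable_fun setT (fun t => f t i j)) -> measurable_fun setT f.
Proof.
move=> mf; apply: (@measurability _ _ _ _ _ _ (@open 'M[R]_(m, n))) => //.
move=> _ [A oA <-]; rewrite setTI (open_mx_countable_cubes oA).
rewrite preimage_bigcup bigcup_mkcond; apply: countable_bigcupT_measurable => [|q]; first exact: countableP.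
case: ifPn => [|_]; last exact: measurable0.
rewrite inE /= => -[q0 _].
rewrite (_ : _ @^-1` _ = \big[setI/setT]_i \big[setI/setT]_j
  (fun t => f t i j) @^-1` ball (map_mx ratr q.1 i j : R) (ratr q.2)).
  apply: bigsetI_measurable => i _; apply: bigsetI_measurable => j _.
  by rewrite -[X in measurable X]setTI; apply: mf => //; exact: measurable_ball.
apply/seteqP; split => t /=.
  move=> [_ ft]; rewrite -bigcap_seq => i _ /=.
  by rewrite -bigcap_seq => j _ /=; exact: ft.
rewrite -bigcap_seq => ft; split => // i j.
by have := ft i (mem_index_enum i); rewrite -bigcap_seq; apply; exact: mem_index_enum.
Qed.

End borel_mx.

Section lebesgue_rV.
Context (R : realType).

Definition consr m (p : R * 'rV[R]_m) : 'rV[R]_m.+1 :=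
  row_mx (const_mx p.1 : 'rV_1) p.2.

Definition unconsr m (x : 'rV[R]_m.+1) : R * 'rV[R]_m :=
  (x ord0 ord0, rsubmx (x : 'rV_(1 + m))).

Lemma consr0 m (p : R * 'rV[R]_m) : consr p ord0 ord0 = p.1.
Proof.
have -> : ord0 = lshift m (ord0 : 'I_1) :> 'I_m.+1 by exact/val_inj.
by rewrite [LHS](row_mxEl (const_mx p.1 : 'rV_1) p.2) mxE.
Qed.

Lemma consr_lift m (p : R * 'rV[R]_m) i :
  consr p ord0 (lift ord0 i) = p.2 ord0 i.
Proof.
have -> : lift ord0 i = rshift 1 i :> 'I_m.+1 by exact/val_inj.
exact: (row_mxEr (const_mx p.1 : 'rV_1) p.2).
Qed.

Lemma consrK m : cancel (@consr m) (@unconsr m).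
Proof. by move=> [a x]; rewrite /unconsr consr0 row_mxKr. Qed.

Lemma measurable_consr m : measurable_fun setT (@consr m).
Proof.
apply: measurable_fun_mx => i j; rewrite [i]ord1.
case: (unliftP ord0 j) => [k ->|->].
  under eq_fun do rewrite consr_lift.
  exact: (measurableT_comp (@measurable_coord_mx R 1 m ord0 k) measurable_snd).
by under eq_fun do rewrite consr0; exact: measurable_fst.
Qed.

Lemma measurable_unconsr m : measurable_fun setT (@unconsr m).
Proof.
apply: measurable_fun_pair; first exact: measurable_coord_mx.
apply: measurable_fun_mx => i j.
by under eq_fun do rewrite mxE; exact: measurable_coord_mx.
Qed.

Section lebesgue_step.
Context m (mu : {sigma_finite_measure set 'rV[R]_m -> \bar R}).
Local Open Scope ereal_scope.

Definition lebesgue_step : set 'rV[R]_m.+1 -> \bar R :=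
  pushforward (lebesgue_measure \x mu) (@consr m).

Let lebesgue_step0 : lebesgue_step set0 = 0.
Proof. by rewrite /lebesgue_step /pushforward preimage_set0 measure0. Qed.

Let lebesgue_step_ge0 A : 0 <= lebesgue_step A.
Proof. by rewrite /lebesgue_step /pushforward; exact: measure_ge0. Qed.

Let lebesgue_step_sigma_additive : semi_sigma_additive lebesgue_step.
Proof.
move=> F mF tF mUF; rewrite /lebesgue_step /pushforward preimage_bigcup.
apply: measure_semi_sigma_additive.
- by move=> n; rewrite -[X in measurable X]setTI; exact: measurable_consr.
- apply/trivIsetP => /= i j _ _ ij; rewrite -preimage_setI.
  by move/trivIsetP : tF => /(_ _ _ _ _ ij) ->//; rewrite preimage_set0.
- by rewrite -preimage_bigcup -[X in measurable X]setTI; exact: measurable_consr.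
Qed.

HB.instance Definition _ := isMeasure.Build _ _ _ lebesgue_step
  lebesgue_step0 lebesgue_step_ge0 lebesgue_step_sigma_additive.

Let lebesgue_step_sigma_finite : sigma_finite setT lebesgue_step.
Proof.
have /sigma_finiteP[F [FT ndF Foo]] := sigma_finiteT (@lebesgue_measure R).
have /sigma_finiteP[G [GT ndG Goo]] := sigma_finiteT mu.
exists (fun n => @unconsr m @^-1` (F n `*` G n)).
  rewrite -preimage_bigcup [X in _ @^-1` X](_ : _ = setT) ?preimage_setT//.
  apply/seteqP; split => // -[a x] _.
  have : [set: R] a by []. rewrite FT => -[k _ Fa].
  have : [set: 'rV[R]_m] x by []. rewrite GT => -[l _ Gx].
  exists (maxn k l) => //; split => /=.
    by move: a Fa; exact/subsetPset/ndF/leq_maxl.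
  by move: x Gx; exact/subsetPset/ndG/leq_maxr.
move=> n; have [mF Fn] := Foo n; have [mG Gn] := Goo n; split.
  rewrite -[X in measurable X]setTI; apply: measurable_unconsr => //.
  exact: measurableX.
rewrite /lebesgue_step /pushforward [X in (_ \x _) X](_ : _ = F n `*` G n).
  by rewrite product_measure1E// lte_mul_pinfty// ge0_fin_numE.
by rewrite -comp_preimage (_ : _ \o _ = id) ?preimage_id//; apply/funext; exact: consrK.
Qed.

HB.instance Definition _ := Measure_isSigmaFinite.Build _ _ _ lebesgue_step
  lebesgue_step_sigma_finite.

End lebesgue_step.

(* m-fold product of the Lebesgue measure on the line (m = 0: unit mass) *)
Fixpoint lebesgue_rV m : {sigma_finite_measure set 'rV[R]_m -> \bar R} :=
  if m is m'.+1 then lebesgue_step (lebesgue_rV m') else \d_(0 : 'rV[R]_0).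

Lemma measurable_rV_box m (A : 'I_m -> set R) : (forall i, measurable (A i)) ->
  measurable [set x : 'rV[R]_m | forall i, A i (x ord0 i)].
Proof.
move=> mA; rewrite (_ : mkset _ = \big[setI/setT]_i
    (fun x : 'rV[R]_m => x ord0 i) @^-1` A i).
  apply: bigsetI_measurable => i _; rewrite -[X in measurable X]setTI.
  exact: measurable_coord_mx.
rewrite -bigcap_seq; apply/seteqP; split => x /= Ax i; first by move=> _; exact: Ax.
exact/Ax/mem_index_enum.
Qed.

Lemma lebesgue_rV_box m (A : 'I_m -> set R) : (forall i, measurable (A i)) ->
  lebesgue_rV m [set x | forall i, A i (x ord0 i)] =
  (\prod_(i < m) lebesgue_measure (A i))%E.
Proof.
elim: m A => [|m ih] A mA.
  by rewrite big_ord0 /= diracE mem_set// => -[].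
rewrite big_ord_recl -ih// /= /lebesgue_step /pushforward.
have mAl := @measurable_rV_box m (A \o lift ord0) (fun i => mA (lift ord0 i)).
rewrite -[RHS](product_measure1E lebesgue_measure (lebesgue_rV m) (mA ord0) mAl).
congr (_ _); apply/seteqP; split => -[a x] /= => [Ax|[Aa Ax] i].
  split=> [|i]; first by have := Ax ord0; rewrite consr0.
  by have := Ax (lift ord0 i); rewrite consr_lift.
by case: (unliftP ord0 i) => [k ->|->]; rewrite ?consr_lift ?consr0.
Qed.

End lebesgue_rV.

Section euclidean_ball.
Context (R : realType) (m : nat).

Definition enorm (x : 'rV[R]_m) : R := Num.sqrt (\sum_(i < m) x ord0 i ^+ 2).

Definition eball (x : 'rV[R]_m) (r : R) : set 'rV[R]_m :=
  [set y | enorm (y - x) < r].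

End euclidean_ball.

(* L^2(U).  An element is represented by a function on the whole of R^m whose
   values outside U are irrelevant: [f \_ U] is [f] extended by 0 off U.
   Functions are not quotiented by a.e. equality. *)
Section L2.
Context (R : realType) (m : nat) (U : set 'rV[R]_m).
Local Notation E := ('rV[R]_m).
Local Notation mu := (lebesgue_rV R m).

Definition L2 : set (E -> R) := [set f | f \_ U \in Lfun mu 2%:E].

Definition L2norm (f : E -> R) : \bar R := 'N[mu]_2%:E[EFin \o (f \_ U)]%E.

Definition L2dot (f g : E -> R) : R := \int[mu]_(x in U) (f x * g x).

Definition orthonormal_basis (e : nat -> E -> R) : Prop :=
  [/\ forall i, L2 (e i),
      forall i j, L2dot (e i) (e j) = (i == j)%:R &
      forall f, L2 f ->
        L2norm (fun x => f x - \sum_(i < n) L2dot f (e i) * e i x)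
          @[n --> \oo] --> 0%E].

Definition bounded_operator (O : (E -> R) -> E -> R) : Prop :=
  exists C : R, forall f, L2 f -> L2 (O f) /\ (L2norm (O f) <= C%:E * L2norm f)%E.

Definition integral_operator (K : E -> E -> R) (f : E -> R) (t : E) : R :=
  \int[mu]_(s in U) (K t s * f s).

(* The integral [K f t] is only required to exist for almost every [t] (the null
   set may depend on [f]).  Linearity, and invariance under a.e. equality, follow
   from the formula. *)
Definition bounded_integral_operator (K : E -> E -> R) : Prop :=
  (forall f, L2 f -> {ae mu, forall t, U t ->
     mu.-integrable U (fun s => (K t s * f s)%:E)}) /\
  bounded_operator (integral_operator K).

Definition unif_continuous_kernel (K : E -> E -> R) : Prop :=
  forall eps : R, 0 < eps -> exists2 delta : R, 0 < delta &
    forall t s t' s', U t -> U s -> U t' -> U s' ->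
      enorm (t - t') < delta -> enorm (s - s') < delta ->
      `|K t s - K t' s'| < eps.

End L2.

Section gaussian_process.
Context (R : realType) d (T : measurableType d) (P : probability T R).

Definition mutually_independent (X : nat -> {RV P >-> R}) : Prop :=
  forall (s : seq nat) (B : nat -> set R), uniq s -> (forall i, measurable (B i)) ->
    P (\bigcap_(i in [set` s]) (X i @^-1` B i)) =
    (\prod_(i <- s) P (X i @^-1` B i))%E.

Definition iid_std_normal (X : nat -> {RV P >-> R}) : Prop :=
  mutually_independent X /\
  forall i (B : set R), measurable B -> distribution P (X i) B = normal_prob 0 1 B.

Context (m : nat) (U : set 'rV[R]_m).
Local Notation E := ('rV[R]_m).
Local Notation mu := (lebesgue_rV R m).

(* [limn] takes a default value at the outcomes (a null set) where the series
   diverges. *)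
Definition gaussian_process (X : nat -> {RV P >-> R}) (e : nat -> E -> R)
    (O : (E -> R) -> E -> R) (f : E -> R) (w : T) : R :=
  limn (fun n => \sum_(i < n) X i w * L2dot U f (O (e i))).

Definition ball_average (G : (E -> R) -> T -> R) (x : E) (eps : R) (w : T) : R :=
  G (\1_(eball x eps)) w / fine (mu (eball x eps)).

(* [Z] is (a representative of) the limit in L^2(Omega, P), as eps -> 0+, of the
   averages of [G] over the balls B(x, eps). *)
Definition local_value (G : (E -> R) -> T -> R) (x : E) (Z : T -> R) : Prop :=
  [/\ Z \in Lfun P 2%:E,
      (\forall eps \near 0^'+, ball_average G x eps \in Lfun P 2%:E) &
      'N[P]_2%:E[EFin \o (ball_average G x eps \- Z)%R]%E
        @[eps --> 0^'+] --> 0%E].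

Definition locally_continuous (G : (E -> R) -> T -> R) (x : E) : Prop :=
  exists Z, local_value G x Z.

End gaussian_process.

(* Main.v *)
(* Write k_t = K(t, .) on U.  Testing K on truncations of k_t shows that every
   k_t is in L^2(U), and uniform continuity of K makes t |-> k_t continuous into
   L^2(U).  The normalized i-th coefficient of the process on B(t, eps) is the
   average over u in B(t, eps) of <k_u, e_i>, so by Bessel these coefficients are
   l^2-close to (<k_t, e_i>)_i.  For l^2 coefficients c, Kolmogorov's maximal
   inequality gives almost sure convergence of sum_i c_i X_i, and c |-> sum_i c_i X_i
   is an isometry from l^2 to L^2(P).  Hence the averages converge to
   sum_i <k_t, e_i> X_i, and the covariance is <k_u1, k_u2> by Parseval. *)

Require Import Defs.
From HB Require Import structures.
From mathcomp Require Import all_boot all_order all_algebra.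
From mathcomp Require Import all_classical all_reals all_analysis.
From mathcomp Require Import measurable_realfun ring lra.

Set Implicit Arguments.
Unset Strict Implicit.
Unset Printing Implicit Defensive.
Import Order.TTheory GRing.Theory Num.Theory.
Import numFieldNormedType.Exports.

Local Open Scope classical_set_scope.
Local Open Scope ring_scope.

(** * Moments of the standard normal law *)

Section normal_moments.
Context (R : realType).
Local Notation mu := (@lebesgue_measure R).
Local Notation N01 := (@normal_prob R 0 1).

(** Three obstacles shape the argument. The set [U] has finite measure but may be unbounded, so
    uniform continuity does not bound k_t. Boundedness of the operator controls a truncation g of
    k_t because, for u near t, (K g)(u) equals ||g||^2 up to an error of order ||g||; integrating
    the square over a ball bounds ||g||^4 by a constant times ||g||^2. The averages of <k_u, e_i>
    must be compared with <k_t, e_i> for all i at once: the error vector is tested against itself,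
    so only finite sums are exchanged with integrals. On the probabilistic side everything rests on
    one symmetry: X_j is symmetric and independent of its past, so replacing X_j by -X_j keeps its
    joint law with any V determined by the past, and E(V X_j) = 0. This gives the centring, the
    orthogonality of the increments and the estimate behind the maximal inequality. Finally, local
    values are determined only up to null sets, so the covariance is computed for arbitrary
    representatives. *)

Lemma integral_normal_prob (f : R -> \bar R) (U : set R) : measurable U ->
  N01.-integrable U f ->
  (\int[N01]_(x in U) f x = \int[mu]_(x in U) (f x * (normal_pdf 0 1 x)%:E))%E.
Proof.
move=> mU fi; have N01mu : N01 `<< mu := @normal_prob_dominates R 0 1.
rewrite -(Radon_Nikodym_change_of_variables N01mu)//.
have mf := measurable_int _ fi.
apply: ae_eq_integral => //.
- apply: emeasurable_funM => //; apply: (measurable_int mu).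
  by apply: (integrableS measurableT) => //; exact: Radon_Nikodym_integrable.
- apply: emeasurable_funM => //; apply/measurableT_comp => //.
  by apply/measurable_funTS; exact: measurable_normal_pdf.
(* The Radon-Nikodym derivative and the density have the same integral over every measurable set, so
   they agree almost everywhere. *)
- apply: ae_eqe_mul2l; rewrite Radon_NikodymE//=; case: cid => /= h [h1 h2 h3].
  apply: integral_ae_eq => //=.
  + exact: integrableS h2.
  + by apply/measurable_funTS/measurableT_comp =>//; exact: measurable_normal_pdf.
  + by move=> E EU mE; rewrite -h3.
Qed.

(** The density is even and Lebesgue measure is invariant under reflection. This symmetry is what
    later makes [X j] orthogonal to its past. *)
Lemma normal_prob_sym (A : set R) : measurable A ->
  N01 ((fun x => - x) @^-1` A) = N01 A.
Proof.
move=> mA; rewrite /normal_prob.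
rewrite [RHS](eq_measure_integral (pushforward mu (-%R : _ -> measurableTypeR R))).
  rewrite ge0_integral_pushforward//.
  - apply: eq_integral => x _ /=; congr EFin; rewrite !normal_pdfE ?oner_eq0//.
    by rewrite /normal_fun !subr0 sqrrN.
  - by apply/measurable_EFinP/measurable_funTS; exact: measurable_normal_pdf.
  - by move=> x _; rewrite lee_fin normal_pdf_ge0.
by move=> B mB _; exact/esym/lebesgue_measureN.
Qed.

Let phi := @normal_pdf R 0 1.

Let phiE : phi = (fun x => normal_peak 1 * expR (- x ^+ 2 / 2)).
Proof.
apply/funext => x; rewrite /phi normal_pdfE ?oner_eq0// /normal_fun.
by rewrite subr0 expr1n mulr2n.
Qed.


(** Since phi' = - x phi, the function - x phi is a primitive of (x^2 - 1) phi. Writing x^2 = (x^2 -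
    1) + 1 then gives the second moment over [-a, a] as the mass of the interval minus the boundary
    term 2 a phi(a). *)
Let is_derive_xphi (x : R) :
  is_derive x 1 (fun x => - (x * phi x)) ((x ^+ 2 - 1) * phi x).
Proof.
have dphi : is_derive x 1 phi (- x * phi x).
  rewrite phiE; pose g := (fun x : R => (- 2^-1) *: (x ^+ 2)).
  have -> : (fun x : R => normal_peak 1 * expR (- x ^+ 2 / 2)) =
      (fun x : R => normal_peak 1 *: (expR \o g) x).
    by apply/funext => y; rewrite /g /= /GRing.scale/=; congr (_ * expR _); ring.
  have dg : is_derive x 1 g (- x).
    by apply: is_derive_eq; rewrite /GRing.scale/=; field.
  have dh : is_derive x (1:R) (expR \o g) (expR (g x) * (- x)).
    by apply: is_derive1_comp.
  apply: is_derive_eq; rewrite /GRing.scale/= /g.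
  have -> : - x ^+ 2 / 2 = (- 2^-1) *: (x ^+ 2) by rewrite /GRing.scale/=; ring.
  ring.
have -> : (fun x => - (x * phi x)) = - (id * phi) by [].
by apply: is_derive_eq; rewrite /GRing.scale/=; ring.
Qed.

Let continuous_phi : continuous phi.
Proof. by apply: continuous_normal_pdf; rewrite oner_eq0. Qed.

Let continuous_polyphi (c : R) : continuous (fun x : R => (x ^+ 2 - c) * phi x : R).
Proof.
move=> x; apply: cvgM; last exact: continuous_phi.
by apply: cvgB; [exact: exprn_continuous|exact: cvg_cst].
Qed.

Let integrable_itv (f : R -> R) (a b : R) : continuous f ->
  mu.-integrable `[a, b] (EFin \o f).
Proof.
move=> cf; apply: continuous_compact_integrable; first exact: segment_compact.
exact: continuous_subspaceT.
Qed.

Let F (n : nat) : set R := `[- n.+1%:R, n.+1%:R].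

Let integral_truncated (n : nat) :
  (\int[N01]_(x in F n) (x ^+ 2)%:E =
   N01 (F n) - (2 * (n.+1%:R * phi n.+1%:R))%:E)%E.
Proof.
rewrite /F; set a : R := n.+1%:R.
have a0 : 0 < a by rewrite ltr0n.
rewrite integral_normal_prob//; last first.
  apply: measurable_bounded_integrable => //.
  exact: (le_lt_trans (probability_le1 _ _) (ltry _)).
  exists (a ^+ 2); split; first exact: num_real.
  move=> M aM x /=; rewrite in_itv/= => /andP[ax xa].
  rewrite (le_trans _ (ltW aM))// normrX ler_sqr ?nnegrE// ?(ltW a0)//.
  by rewrite ler_norml ax.
under eq_integral do rewrite -EFinM -/phi.
have iphi := @integrable_itv _ (- a) a continuous_phi.
have i1 := @integrable_itv _ (- a) a (@continuous_polyphi 1).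
have -> : (fun x => (x ^+ 2 * phi x)%:E) =
    ((EFin \o (fun x => (x ^+ 2 - 1)%R * phi x)%R) \+ (EFin \o phi))%E.
  by apply/funext => x/=; rewrite -EFinD; congr EFin; ring.
rewrite integralD// addeC; congr (_ + _)%E.
rewrite (@continuous_FTC2 _ _ (fun x => - (x * phi x)))//.
- rewrite -EFinB -EFinN phiE sqrrN; congr EFin; ring.
- by rewrite gtrN.
- exact/continuous_subspaceT/continuous_polyphi.
- have cF (x : R) : (fun x : R => - (x * phi x)) @ x --> (- (x * phi x) : R).
    by apply: cvgN; apply: cvgM; [exact: cvg_id|exact: continuous_phi].
  split.
  + by move=> x _; have [] := is_derive_xphi x.
  + exact: cvg_at_right_filter.
  + exact: cvg_at_left_filter.
- by move=> x _; rewrite derive1E; have [_ ->] := is_derive_xphi x.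
Qed.

Let cvg_nphi : (2 * (n.+1%:R * phi n.+1%:R))%:E @[n --> \oo] --> (0 : \bar R).
Proof.
apply: cvg_EFin; first by near=> n.
rewrite /comp/=.
(* The majorant comes from a^2 / 2 <= exp(a^2 / 2), which yields 2 a exp(- a^2 / 2) <= 4 / a. *)
apply: (@squeeze_cvgr _ _ _ _ (fun=> 0) (fun n => (4 * normal_peak 1) * n.+1%:R^-1)).
- near=> n; rewrite !mulr_ge0 ?normal_pdf_ge0//= phiE.
  set a : R := n.+1%:R; have a0 : 0 < a by rewrite ltr0n.
  have -> : - a ^+ 2 / 2 = - (a ^+ 2 / 2) by rewrite mulNr.
  rewrite expRN.
  have -> : 2 * (a * (normal_peak 1 * (expR (a ^+ 2 / 2))^-1)) =
    normal_peak 1 * (2 * a / expR (a ^+ 2 / 2)) by ring.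
  have -> : 4 * normal_peak 1 / a = normal_peak 1 * (4 / a) by ring.
  apply: ler_wpM2l; first exact: normal_peak_ge0.
  rewrite ler_pdivrMr ?expR_gt0// -mulrAC ler_pdivlMr//.
  have h : a ^+ 2 / 2 <= expR (a ^+ 2 / 2).
    by rewrite (le_trans _ (expR_ge1Dx _))// lerDr.
  have := h; set e := expR _; nra.
- exact: cvg_cst.
- rewrite -[X in _ --> X](mulr0 (4 * normal_peak 1)); apply: cvgMr.
  exact: cvg_harmonic.
Unshelve. all: by end_near. Qed.

Lemma normal_prob_second_moment : (\int[N01]_x (x ^+ 2)%:E = 1)%E.
Proof.
have FT : \bigcup_n F n = setT.
  apply/seteqP; split => // x _; exists (Num.bound `|x|) => //.
  rewrite /F /= in_itv/= -ler_norml.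
  by rewrite (le_trans (ltW (archi_boundP (normr_ge0 x))))// ler_nat.
have ndF : nondecreasing_seq F.
  move=> m n mn; apply/subsetPset => x; rewrite /F/= !in_itv/= -!ler_norml.
  by move=> /le_trans; apply; rewrite ler_nat.
have mF n : measurable (F n) by exact: measurable_itv.
have h1 : (\int[N01]_(x in F n) (x ^+ 2)%:E)%E @[n --> \oo] -->
    (\int[N01]_x (x ^+ 2)%:E)%E.
  rewrite -FT; apply: ge0_nondecreasing_set_cvg_integral => //.
  - by move=> n; apply/measurable_EFinP; exact: measurable_funX.
  - by move=> n x _; rewrite lee_fin sqr_ge0.
have h2 : (\int[N01]_(x in F n) (x ^+ 2)%:E)%E @[n --> \oo] --> (1%E : \bar R).
  rewrite (_ : (fun n => _) = (fun n =>
    N01 (F n) - (2 * (n.+1%:R * phi n.+1%:R))%:E)%E); last first.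
    by apply/funext => n; exact: integral_truncated.
  rewrite -[X in _ --> X](sube0 1%E); apply: cvgeB => //.
  rewrite -(probability_setT N01) -FT; apply: nondecreasing_cvg_mu => //.
  by rewrite FT.
by apply: (cvg_unique _ h1 h2); exact: ereal_hausdorff.
Qed.

End normal_moments.

(** * Inner product of L^2 *)

Section L2_inner_product.
Context d (T : measurableType d) (R : realType) (mu : {measure set T -> \bar R}).
Implicit Types f g h : T -> R.

Lemma Lfun2_measurable f : f \in Lfun mu 2%:E -> measurable_fun setT f.
Proof. by rewrite inE => /andP[/[!inE]]. Qed.

Lemma Lnorm2E f : ('N[mu]_2%:E[EFin \o f] =
  (\int[mu]_x (f x ^+ 2)%:E) `^ 2^-1)%E.
Proof.
rewrite unlock; congr (_ `^ _)%E; apply: eq_integral => x _ /=.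
by rewrite powR_mulrn// real_normK// num_real.
Qed.

Lemma Lfun2_integral_sqr f : measurable_fun setT f ->
  (\int[mu]_x (f x ^+ 2)%:E < +oo)%E -> f \in Lfun mu 2%:E.
Proof.
move=> mf fi; rewrite inE; apply/andP; split; rewrite inE//=.
by rewrite /finite_norm Lnorm2E poweR_lty.
Qed.

Lemma Lfun2D f g : f \in Lfun mu 2%:E -> g \in Lfun mu 2%:E ->
  (fun x => f x + g x) \in Lfun mu 2%:E.
Proof. exact: (Lfun_addr_closed mu (lee1n 2)).2. Qed.

Lemma Lfun2N f : f \in Lfun mu 2%:E -> (fun x => - f x) \in Lfun mu 2%:E.
Proof. exact: Lfun_oppr_closed. Qed.

Lemma Lfun2B f g : f \in Lfun mu 2%:E -> g \in Lfun mu 2%:E ->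
  (fun x => f x - g x) \in Lfun mu 2%:E.
Proof. by move=> lf lg; exact: Lfun2D lf (Lfun2N lg). Qed.

Lemma Lfun2Z a f : f \in Lfun mu 2%:E -> (fun x => a * f x) \in Lfun mu 2%:E.
Proof.
move=> lf; rewrite (_ : (fun x => _) = a \o* f).
  by apply: Lfun_scale; rewrite ?ler1n.
by apply/funext => x /=; rewrite mulrC.
Qed.

Lemma Lfun2_sum (F : nat -> T -> R) n : (forall i, F i \in Lfun mu 2%:E) ->
  (fun x => \sum_(i < n) F i x) \in Lfun mu 2%:E.
Proof.
move=> lF; elim: n => [|n ih].
  rewrite (_ : (fun _ => _) = (fun x => 0 * F 0%N x)); first exact: Lfun2Z.
  by apply/funext => x; rewrite big_ord0 mul0r.
rewrite (_ : (fun _ => _) = (fun x => \sum_(i < n) F i x + F n x)).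
  exact: Lfun2D.
by apply/funext => x; rewrite big_ord_recr.
Qed.

Lemma Lfun2_integrableM f g : f \in Lfun mu 2%:E -> g \in Lfun mu 2%:E ->
  mu.-integrable setT (EFin \o (fun x => f x * g x)).
Proof. by move=> lf lg; exact/Lfun1_integrable/Lfun2_mul_Lfun1. Qed.

Definition ip f g : R := \int[mu]_x (f x * g x).

Lemma ipC f g : ip f g = ip g f.
Proof. by apply: eq_Rintegral => x _; rewrite mulrC. Qed.

Lemma ipDl f g h : f \in Lfun mu 2%:E -> g \in Lfun mu 2%:E ->
  h \in Lfun mu 2%:E -> ip (fun x => f x + g x) h = ip f h + ip g h.
Proof.
move=> lf lg lh; rewrite /ip -RintegralD//; try exact: Lfun2_integrableM.
by apply: eq_Rintegral => x _; rewrite mulrDl.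
Qed.

Lemma ipZl a f g : f \in Lfun mu 2%:E -> g \in Lfun mu 2%:E ->
  ip (fun x => a * f x) g = a * ip f g.
Proof.
move=> lf lg; rewrite /ip -RintegralZl//; last exact: Lfun2_integrableM.
by apply: eq_Rintegral => x _; rewrite mulrA.
Qed.

Lemma ipDr f g h : f \in Lfun mu 2%:E -> g \in Lfun mu 2%:E ->
  h \in Lfun mu 2%:E -> ip h (fun x => f x + g x) = ip h f + ip h g.
Proof. by move=> lf lg lh; rewrite ipC ipDl// !(ipC _ h). Qed.

Lemma ipZr a f g : f \in Lfun mu 2%:E -> g \in Lfun mu 2%:E ->
  ip g (fun x => a * f x) = a * ip g f.
Proof. by move=> lf lg; rewrite ipC ipZl// ipC. Qed.

Lemma ip0l g : ip (fun=> 0) g = 0.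
Proof.
by rewrite /ip /Rintegral; under eq_integral do rewrite mul0r; rewrite integral0.
Qed.

Lemma ipNl f g : f \in Lfun mu 2%:E -> g \in Lfun mu 2%:E ->
  ip (fun x => - f x) g = - ip f g.
Proof.
move=> lf lg; rewrite -mulN1r -ipZl//; congr ip.
by apply/funext => x; rewrite mulN1r.
Qed.

Lemma ipBl f g h : f \in Lfun mu 2%:E -> g \in Lfun mu 2%:E ->
  h \in Lfun mu 2%:E -> ip (fun x => f x - g x) h = ip f h - ip g h.
Proof. by move=> lf lg lh; rewrite ipDl ?ipNl ?Lfun2N. Qed.

Lemma ipBr f g h : f \in Lfun mu 2%:E -> g \in Lfun mu 2%:E ->
  h \in Lfun mu 2%:E -> ip h (fun x => f x - g x) = ip h f - ip h g.
Proof. by move=> lf lg lh; rewrite ipC ipBl// !(ipC _ h). Qed.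

Lemma ip_suml (F : nat -> T -> R) n g : (forall i, F i \in Lfun mu 2%:E) ->
  g \in Lfun mu 2%:E ->
  ip (fun x => \sum_(i < n) F i x) g = \sum_(i < n) ip (F i) g.
Proof.
move=> lF lg; elim: n => [|n ih].
  rewrite big_ord0 -[RHS](ip0l g); congr ip.
  by apply/funext => x; rewrite big_ord0.
rewrite big_ord_recr/= -ih -ipDl//; last exact: Lfun2_sum.
by congr ip; apply/funext => x; rewrite big_ord_recr.
Qed.

Lemma ip_ge0 f : 0 <= ip f f.
Proof. by apply: Rintegral_ge0 => x _; rewrite -expr2 sqr_ge0. Qed.

Lemma ipE f : f \in Lfun mu 2%:E ->
  (\int[mu]_x (f x ^+ 2)%:E = (ip f f)%:E)%E.
Proof.
move=> lf; rewrite /ip /Rintegral fineK.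
  by apply: eq_integral => x _; rewrite expr2.
exact/integrable_fin_num/Lfun2_integrableM.
Qed.

Lemma Lnorm2_sqrt f : f \in Lfun mu 2%:E ->
  'N[mu]_2%:E[EFin \o f]%E = (Num.sqrt (ip f f))%:E.
Proof. by move=> lf; rewrite Lnorm2E ipE// poweR_EFin -powR12_sqrt ?ip_ge0. Qed.

Lemma ip_sqrB f g : f \in Lfun mu 2%:E -> g \in Lfun mu 2%:E ->
  ip (fun x => f x - g x) (fun x => f x - g x) = ip f f - 2 * ip f g + ip g g.
Proof.
move=> lf lg; have lfg := Lfun2B lf lg.
by rewrite ipBl// !ipBr// (ipC g f); ring.
Qed.

(** Parallelogram law with the square of f + g dropped; it serves as a triangle inequality for
    squared norms. *)
Lemma ip_sqrB_le f g : f \in Lfun mu 2%:E -> g \in Lfun mu 2%:E ->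
  ip (fun x => f x - g x) (fun x => f x - g x) <= 2 * ip f f + 2 * ip g g.
Proof.
move=> lf lg; rewrite ip_sqrB//.
have := ip_ge0 (fun x => f x + g x).
rewrite ipDl ?Lfun2D// !ipDr// (ipC g f) => h.
by rewrite -subr_ge0; apply: le_trans h _; lra.
Qed.

Lemma cauchy_schwarz f g : f \in Lfun mu 2%:E -> g \in Lfun mu 2%:E ->
  ip f g ^+ 2 <= ip f f * ip g g.
Proof.
move=> lf lg.
have key t : 0 <= ip f f - 2 * t * ip f g + t ^+ 2 * ip g g.
  have := ip_ge0 (fun x => f x - t * g x).
  rewrite ip_sqrB ?Lfun2Z// ipZl ?Lfun2Z// !(ipC _ (fun x => t * g x)).
  by rewrite !ipZl// (ipC g f) expr2 !mulrA.
have [g0|g0] := eqVneq (ip g g) 0.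
  rewrite g0 mulr0; set b := ip f g.
  have [->|b0] := eqVneq b 0; first by rewrite expr0n.
  (* When <g, g> = 0 the expression in [key] is affine in t; at this t it equals -1. *)
  have := key ((ip f f + 1) / (2 * b)); rewrite g0 mulr0 addr0 -/b.
  have -> : 2 * ((ip f f + 1) / (2 * b)) * b = ip f f + 1 by field.
  lra.
have {}g0 : 0 < ip g g by rewrite lt_neqAle eq_sym g0 ip_ge0.
(* The minimizer of the quadratic polynomial in t. *)
have := key (ip f g / ip g g).
have -> : ip f f - 2 * (ip f g / ip g g) * ip f g + (ip f g / ip g g) ^+ 2 * ip g g
  = (ip f f * ip g g - ip f g ^+ 2) / ip g g by field; exact: lt0r_neq0.
by rewrite pmulr_lge0 ?invr_gt0// subr_ge0.
Qed.

Lemma ip_null f g : f \in Lfun mu 2%:E -> g \in Lfun mu 2%:E ->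
  ip f f = 0 -> ip f g = 0.
Proof.
move=> lf lg f0; apply/eqP; rewrite -sqrf_eq0 eq_le sqr_ge0 andbT.
by rewrite (le_trans (cauchy_schwarz lf lg))// f0 mul0r.
Qed.

Lemma cvg_ipl (I : Type) (F : set_system I) {FF : ProperFilter F} (u : I -> T -> R) f g :
  (forall i, u i \in Lfun mu 2%:E) -> f \in Lfun mu 2%:E ->
  g \in Lfun mu 2%:E ->
  ip (fun x => u i x - f x) (fun x => u i x - f x) @[i --> F] --> (0 : R) ->
  ip (u i) g @[i --> F] --> ip f g.
Proof.
move=> lu lf lg uf; apply/subr_cvg0.
have sq0 : Num.sqrt (ip (fun x => u i x - f x) (fun x => u i x - f x)
    * ip g g) @[i --> F] --> (0 : R).
  rewrite -[X in _ --> X]sqrtr0 -[X in Num.sqrt X](mul0r (ip g g)).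
  by apply: continuous_cvg; [exact: sqrt_continuous|exact: cvgMl].
apply: norm_cvg0.
apply: (squeeze_cvgr _ (cvg_cst 0) sq0).
apply: nearW => i; rewrite normr_ge0/=.
have le := cauchy_schwarz (Lfun2B (lu i) lf) lg.
rewrite -ipBl// -sqrtr_sqr; exact: ler_wsqrtr.
Qed.

Lemma cvg_ip_Lnorm (I : Type) (F : set_system I) {FF : ProperFilter F} (u : I -> T -> R) :
  (\forall i \near F, u i \in Lfun mu 2%:E) ->
  'N[mu]_2%:E[EFin \o u i]%E @[i --> F] --> 0%E <->
  ip (u i) (u i) @[i --> F] --> (0 : R).
Proof.
move=> lu; split=> [u0|u0].
  have : fine ('N[mu]_2%:E[EFin \o u i]%E) ^+ 2 @[i --> F] --> (0 : R).
    rewrite -[X in _ --> X](expr0n R 2).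
    apply: (@continuous_cvg _ _ _ _ _ _ (fun x : R => x ^+ 2)).
      exact: exprn_continuous.
    exact: (fine_cvg u0).
  apply: cvg_trans; apply: near_eq_cvg; near=> i.
  rewrite Lnorm2_sqrt; last by near: i.
  by rewrite /= sqr_sqrtr// ip_ge0.
have : (Num.sqrt (ip (u i) (u i)))%:E @[i --> F] --> (0%E : \bar R).
  apply: cvg_EFin; first by near=> i.
  rewrite /comp/= -[X in _ --> X]sqrtr0.
  by apply: continuous_cvg; first exact: sqrt_continuous.
apply: cvg_trans; apply: near_eq_cvg; near=> i.
by rewrite Lnorm2_sqrt//; near: i.
Unshelve. all: by end_near. Qed.

End L2_inner_product.

(** * Independence of X_j from X_0, ..., X_(j-1) *)

Section independence.
Context (R : realType) d (T : measurableType d) (P : probability T R).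
Context (X : nat -> {RV P >-> R}).
Hypothesis X_iid : iid_std_normal X.
Local Notation N01 := (@normal_prob R 0 1).

(** A pi-system generating the sigma-algebra of X_0, ..., X_(j-1), on which the product formula
    defining independence can be read off directly. *)
Definition cylinders (j : nat) : set (set T) :=
  [set A | exists2 B : nat -> set R, (forall i, measurable (B i)) &
           A = \bigcap_(i in `I_j) (X i @^-1` B i)].

Let measurable_preimage i (B : set R) : measurable B -> measurable (X i @^-1` B).
Proof. by move=> mB; rewrite -[X in measurable X]setTI; exact: measurable_funP. Qed.

Let cylinders_measurable j : cylinders j `<=` measurable.
Proof.
by move=> A [B mB ->]; apply: bigcap_measurableType => // i _; exact: measurable_preimage.
Qed.

Let sub_cylinders j A : <<s cylinders j >> A -> measurable A.
Proof.
by apply: smallest_sub; [exact: sigma_algebra_measurable|exact: cylinders_measurable].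
Qed.

Let cylindersI j : setI_closed (cylinders j).
Proof.
move=> A A' [B mB ->] [B' mB' ->]; exists (fun i => B i `&` B' i).
  by move=> i; exact: measurableI.
by rewrite bigcapI.
Qed.

Let cylindersT j : cylinders j setT.
Proof.
exists (fun=> setT) => //; apply/seteqP; split=> // w _ i _.
Qed.

Let indep_cylinder j A (C : set R) : cylinders j A -> measurable C ->
  P (A `&` X j @^-1` C) = (P A * P (X j @^-1` C))%E.
Proof.
have [indX _] := X_iid.
move=> [B mB ->] mC.
pose B' i := if i == j then C else B i.
have mB' i : measurable (B' i) by rewrite /B'; case: ifP.
have h1 := indX (iota 0 j) B (iota_uniq _ _) mB.
have h2 := indX (iota 0 j.+1) B' (iota_uniq _ _) mB'.
have EA : \bigcap_(i in `I_j) X i @^-1` B i =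
    \bigcap_(i in [set` iota 0 j]) X i @^-1` B i.
  by apply: eq_bigcapl; split=> i /=; rewrite mem_iota.
have EA' : \bigcap_(i in [set` iota 0 j.+1]) X i @^-1` B' i =
    \bigcap_(i in [set` iota 0 j]) X i @^-1` B i `&` X j @^-1` C.
  apply/seteqP; split=> w h.
    split=> [i|]; last first.
      have := h j; rewrite /B' /preimage /mkset eqxx; apply.
      by rewrite mem_iota add0n ltnSn.
    rewrite /mkset mem_iota add0n => /andP[_ ij].
    have := h i; rewrite /B' /preimage /mkset ltn_eqF//; apply.
    by rewrite mem_iota add0n ltnS /= ltnW.
  move=> i; rewrite /mkset mem_iota add0n ltnS /B' => /andP[_ ij].
  have [->|nij] := eqVneq i j; first exact: h.2.
  by apply: h.1; rewrite /mkset mem_iota add0n ltn_neqAle nij.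
rewrite EA -EA' h2 h1 -addn1 iotaD big_cat/= big_seq1 add0n /B' eqxx.
congr (_ * _)%E; apply: eq_big_seq => i; rewrite mem_iota add0n => /andP[_ ij].
by rewrite ltn_eqF.
Qed.

(** As functions of A, both sides are finite measures, P restricted to an event and a multiple of P;
    they agree on a generating pi-system that contains the whole space. *)
Let indep_sigma j A (C : set R) : <<s cylinders j >> A -> measurable C ->
  P (A `&` X j @^-1` C) = (P A * P (X j @^-1` C))%E.
Proof.
move=> sA mC.
have mXC := measurable_preimage j mC.
have p0 : 0 <= fine (P (X j @^-1` C)) by rewrite fine_ge0.
pose m1 := mrestr P mXC.
pose m2 := mscale (NngNum p0) P.
have pE : P (X j @^-1` C) = (fine (P (X j @^-1` C)))%:E.
  by rewrite fineK// fin_num_measure.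
have -> : P (A `&` X j @^-1` C) = m1 A by [].
rewrite muleC.
have -> : (P (X j @^-1` C) * P A)%E = m2 A by rewrite /m2 /mscale/= -pE.
apply: (g_sigma_algebra_measure_unique (cylinders j) _ (fun=> setT)) => //.
- by apply/seteqP; split=> // w _; exists 0%N.
- move=> B cB; rewrite /m1 /m2 /mscale/= /mrestr indep_cylinder// muleC.
  by rewrite /mscale/= -pE.
- by move=> _; rewrite /m1 /= /mrestr setTI (le_lt_trans (probability_le1 _ _))// ltry.
Qed.

(** Measurability with respect to the strict past X_0, ..., X_(j-1), expressed by retyping the
    domain with the generated sigma-algebra, so that the usual closure properties of measurable
    functions apply. *)
Definition adapted j (V : T -> R) :=
  measurable_fun setT (V : g_sigma_algebraType (cylinders j) -> R).

Lemma adapted_measurable j V : adapted j V -> measurable_fun setT V.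
Proof.
move=> aV _ B mB; rewrite setTI; apply: (@sub_cylinders j).
by rewrite -[X in <<s _ >> X]setTI; exact: aV.
Qed.

Lemma adaptedS j V : adapted j V -> adapted j.+1 V.
Proof.
move=> aV _ B mB; have := aV measurableT _ mB.
apply: (sub_sigma_algebra2) => A [C mC ->].
exists (fun i => if (i < j)%N then C i else setT).
  by move=> i; case: ifP.
apply/seteqP; split=> w /= h i /= ij.
  by case: ifP => // ij'; exact: h.
by have := h i; rewrite /= ltnS ij; apply; exact: ltnW.
Qed.

Lemma adaptedX j : adapted j.+1 (X j).
Proof.
move=> _ B mB; rewrite setTI; apply: sub_sigma_algebra.
exists (fun i => if i == j then B else setT); first by move=> i; case: ifP.
apply/seteqP; split=> w /= h; first by move=> i _; case: ifP => // /eqP ->.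
by have := h j; rewrite /= eqxx; apply.
Qed.

Let lawX i (B : set R) : measurable B -> P (X i @^-1` B) = N01 B.
Proof. by move=> mB; have [_ /(_ i B mB)] := X_iid. Qed.

(** The pairs (V, X_j) and (V, -X_j) have the same law, namely the product of the law of V with the
    symmetric law of X_j. Hence E(V X_j) = - E(V X_j). Only the product V X_j has to be integrable,
    which suits the cross terms of the stopped sums. *)
Lemma integral_adaptedM j V : adapted j V ->
  P.-integrable setT (EFin \o (fun w => V w * X j w)) ->
  \int[P]_w (V w * X j w) = 0.
Proof.
move=> aV iVX.
have mV := adapted_measurable aV.
pose VX w := (V w, X j w); pose VNX w := (V w, - X j w).
have mVX : measurable_fun setT VX by exact: measurable_fun_pair.
have mVNX : measurable_fun setT VNX.
  by apply: measurable_fun_pair => //; exact: measurableT_comp.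
pose VX' : {mfun T >-> (R * R)%type} := mfun_Sub (mem_set mVX : VX \in mfun).
pose VNX' : {mfun T >-> (R * R)%type} := mfun_Sub (mem_set mVNX : VNX \in mfun).
pose V' : {mfun T >-> R} := mfun_Sub (mem_set mV : V \in mfun).
have sVB (B : set R) : measurable B -> <<s cylinders j >> (V @^-1` B).
  by move=> mB; rewrite -[X in <<s _ >> X]setTI; exact: aV.
have eqm (S : set (R * R)) : measurable S ->
    distribution P VX' S = distribution P VNX' S.
  move=> mS.
  transitivity ((distribution P V' \x distribution P (X j))%E S).
    apply/esym; apply: (@product_measure_unique _ _ _ _ _ (distribution P V')
      (distribution P (X j))
      (distribution P VX')) => // A B mA mB.
    rewrite -[LHS]/(P (V @^-1` A `&` X j @^-1` B)).
    rewrite -[RHS]/(P (V @^-1` A) * P (X j @^-1` B))%E.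
    by rewrite indep_sigma//; exact: sVB.
  apply: (@product_measure_unique _ _ _ _ _ (distribution P V')
      (distribution P (X j))
    (distribution P VNX')) => // A B mA mB.
  rewrite -[LHS]/(P (V @^-1` A `&` X j @^-1` ((fun x => - x) @^-1` B))).
  rewrite -[RHS]/(P (V @^-1` A) * P (X j @^-1` B))%E.
  have mNB : measurable ((fun x : R => - x) @^-1` B).
    by rewrite -[X in measurable X]setTI; exact: oppr_measurable.
  by rewrite indep_sigma ?lawX ?normal_prob_sym//; exact: sVB.
pose f (p : R * R) := (p.1 * p.2)%:E.
have mf : measurable_fun setT f.
  by apply/measurable_EFinP; exact: measurable_funM.
have iN : P.-integrable setT (f \o VNX').
  rewrite (_ : _ \o _ = -%E \o (EFin \o (fun w => V w * X j w))).
    exact: integrableN.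
  by apply/funext => w; rewrite /f /= mulrN.
have h1 := integral_distribution (X := VX') mf iVX.
have h2 := integral_distribution (X := VNX') mf iN.
have h3 : (\int[P]_x (f \o VX') x = \int[P]_x (f \o VNX') x)%E.
  by rewrite -h1 -h2; apply: eq_measure_integral => A mA _; exact: eqm.
have : \int[P]_w (V w * X j w) = \int[P]_w (- (V w * X j w)).
  rewrite /Rintegral; congr fine; rewrite [LHS]h3; apply: eq_integral => w _.
  by rewrite /f /= mulrN.
have -> : \int[P]_w (- (V w * X j w)) = - \int[P]_w (V w * X j w).
  rewrite -mulN1r -RintegralZl//; apply: eq_Rintegral => w _; exact/esym/mulN1r.
lra.
Qed.

End independence.

(** * Kolmogorov's maximal inequality *)

Section gaussian_sums.
Context (R : realType) d (T : measurableType d) (P : probability T R).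
Context (X : nat -> {RV P >-> R}).
Hypothesis X_iid : iid_std_normal X.
Implicit Types (c : nat -> R) (m n : nat) (w : T).

Lemma normal_second_moment i : (\int[P]_w (X i w ^+ 2)%:E = 1)%E.
Proof.
(* The normal law is stated on [measurableTypeR R] and the law of [X i] on [R]; the identity carries
   one to the other. *)
have mid : measurable_fun setT (idfun : measurableTypeR R -> R).
  by move=> _ B mB; rewrite setTI.
pose idR : {mfun measurableTypeR R >-> R} := 
  HB.pack (idfun : measurableTypeR R -> R) (isMeasurableFun.Build _ _ _ _ _ mid).
have msqr : measurable_fun setT (fun x : R => (x ^+ 2)%:E).
  by apply/measurable_EFinP; exact: measurable_funX.
have sqr0 (x : R) : (0 <= (x ^+ 2)%:E)%E by rewrite lee_fin sqr_ge0.
rewrite -(normal_prob_second_moment R).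
rewrite -[LHS](ge0_integral_distribution (X i) msqr sqr0).
rewrite (eq_measure_integral (pushforward (normal_prob 0 1) idR)).
  by rewrite ge0_integral_pushforward.
by move=> A mA _; have [_ /(_ i A mA)] := X_iid.
Qed.

Lemma normal_Lfun2 i : (X i : T -> R) \in Lfun P 2%:E.
Proof. by apply: Lfun2_integral_sqr => //; rewrite normal_second_moment ltry. Qed.

Lemma ip_normal i : ip P (X i) (X i) = 1.
Proof.
by apply: EFin_inj; rewrite -ipE ?normal_second_moment//; exact: normal_Lfun2.
Qed.

Lemma ip_adapted j (V : T -> R) : V \in Lfun P 2%:E -> adapted X j V ->
  ip P V (X j) = 0.
Proof.
move=> lV aV; apply: (integral_adaptedM X_iid aV).
by apply: Lfun2_integrableM => //; exact: normal_Lfun2.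
Qed.

Definition gsum c n w := \sum_(i < n) X i w * c i.

Lemma gsumS c n w : gsum c n.+1 w = gsum c n w + c n * X n w.
Proof. by rewrite /gsum big_ord_recr/= mulrC. Qed.

Lemma gsum_Lfun2 c n : gsum c n \in Lfun P 2%:E.
Proof.
apply: Lfun2_sum (fun i w => X i w * c i) n _ => i.
rewrite (_ : (fun _ => _) = (fun w => c i * X i w)).
  exact/Lfun2Z/normal_Lfun2.
by apply/funext => w; rewrite mulrC.
Qed.

Lemma adapted_gsum c n : adapted X n (gsum c n).
Proof.
elim: n => [|n ih].
  rewrite (_ : gsum c 0 = cst 0); first exact: measurable_cst.
  by apply/funext => w; rewrite /gsum big_ord0.
rewrite (_ : gsum c n.+1 = (fun w => gsum c n w + c n * X n w)); last first.
  by apply/funext => w; exact: gsumS.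
apply: measurable_funD; first exact: adaptedS.
apply: measurable_funM; first exact: measurable_cst.
exact: adaptedX.
Qed.

(** The cross terms vanish in the induction because a partial sum of n terms depends only on the
    past of [X n]. *)
Lemma ip_gsum a b n : ip P (gsum a n) (gsum b n) = \sum_(i < n) a i * b i.
Proof.
have gS c k : gsum c k.+1 = (fun w => gsum c k w + c k * X k w).
  by apply/funext => w; exact: gsumS.
have g0 c : gsum c 0 = (fun=> 0) by apply/funext => w; rewrite /gsum big_ord0.
elim: n => [|n ih]; first by rewrite big_ord0 !g0 ip0l.
have lX := normal_Lfun2 n.
have lcX (c : nat -> R) : (fun w => c n * X n w) \in Lfun P 2%:E by exact: Lfun2Z.
have la c := gsum_Lfun2 c n.
have laX c : (fun w => gsum c n w + c n * X n w) \in Lfun P 2%:E by exact: Lfun2D.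
have i0 c : ip P (gsum c n) (X n) = 0 by apply: ip_adapted => //; exact: adapted_gsum.
rewrite big_ord_recr/= -ih !gS ipDl// !ipDr// !ipZl// !ipZr// i0.
by rewrite (ipC _ (X n) (gsum b n)) i0 ip_normal; ring.
Qed.

(** The constant 1 is adapted, so orthogonality to the past contains the fact that each [X n] has
    mean zero. *)
Lemma integral_gsum c n : \int[P]_w gsum c n w = 0.
Proof.
have l1 : (fun=> 1) \in Lfun P 2%:E by exact: Lfun_cst.
transitivity (ip P (gsum c n) (fun=> 1)).
  by apply: eq_Rintegral => w _; rewrite mulr1.
elim: n => [|n ih].
  rewrite (_ : gsum c 0 = (fun=> 0)) ?ip0l//.
  by apply/funext => w; rewrite /gsum big_ord0.
rewrite (_ : gsum c n.+1 = (fun w => gsum c n w + c n * X n w)); last first.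
  by apply/funext => w; exact: gsumS.
rewrite ipDl ?ih ?add0r//; [|exact: gsum_Lfun2|exact/Lfun2Z/normal_Lfun2].
rewrite ipZl//; last exact: normal_Lfun2.
rewrite ipC ip_adapted ?mulr0//.
by apply: measurable_cst.
Qed.

Section maximal_inequality.
Context (c : nat -> R) (lam : R).
Hypothesis lam0 : 0 < lam.

(* The partial sums, frozen from the first exit of ]-lam, lam[ on: their second
   moment is still at most the sum of the [c i ^+ 2], and they stay outside
   ]-lam, lam[ as soon as some partial sum has left it. *)
Fixpoint stopped n w : R :=
  if n is n'.+1 then
    stopped n' w + (if `|stopped n' w| < lam then c n' else 0) * X n' w
  else 0.

(** The coefficient of the n-th increment of [stopped]. Whether it is [c n] or 0 is decided before
    X_n is seen, which makes it adapted at n. *)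
Let running n w := if `|stopped n w| < lam then c n else 0.

Let adapted_running n : adapted X n (stopped n) -> adapted X n (running n).
Proof.
move=> aY; apply: measurable_fun_ifT; try exact: measurable_cst.
apply: measurable_fun_ltr; last exact: measurable_cst.
exact: measurableT_comp.
Qed.

Let adapted_stopped n : adapted X n (stopped n).
Proof.
elim: n => [|n ih]; first exact: measurable_cst.
apply: measurable_funD; first exact: adaptedS.
apply: measurable_funM; last exact: adaptedX.
exact: (adaptedS (adapted_running ih)).
Qed.

Let running_le n w : running n w ^+ 2 <= c n ^+ 2.
Proof. by rewrite /running; case: ifP => // _; rewrite expr0n sqr_ge0. Qed.

Let increment_sqr n :
  (\int[P]_w ((running n w * X n w) ^+ 2)%:E <= (c n ^+ 2)%:E)%E.
Proof.
have mH := adapted_measurable (adapted_running (@adapted_stopped n)).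
rewrite -[leRHS]mule1 -(normal_second_moment n) -ge0_integralZl_EFin ?sqr_ge0//.
- apply: ge0_le_integral => //.
  + by move=> w _; rewrite lee_fin sqr_ge0.
  + by apply/measurable_EFinP/measurable_funX; exact: measurable_funM.
  + apply/measurable_EFinP/measurable_funM; first exact: measurable_cst.
    exact: measurable_funX.
  + by move=> w _; rewrite -EFinM lee_fin exprMn ler_wpM2r ?sqr_ge0.
- by move=> w _; rewrite lee_fin sqr_ge0.
- by apply/measurable_EFinP; exact: measurable_funX.
Qed.

Let increment_Lfun2 n : (fun w => running n w * X n w) \in Lfun P 2%:E.
Proof.
have mH := adapted_measurable (adapted_running (@adapted_stopped n)).
apply: Lfun2_integral_sqr; first exact: measurable_funM.
by rewrite (le_lt_trans (increment_sqr n))// ltry.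
Qed.

Let stopped_Lfun2 n : stopped n \in Lfun P 2%:E.
Proof. by elim: n => [|n ih]; [exact: Lfun_cst|exact: (Lfun2D ih (increment_Lfun2 n))]. Qed.

Let ip_stopped n : ip P (stopped n) (stopped n) <= \sum_(i < n) c i ^+ 2.
Proof.
elim: n => [|n ih].
  by rewrite big_ord0 ip0l.
have -> : stopped n.+1 = (fun w => stopped n w + running n w * X n w) by [].
rewrite big_ord_recr/=.
have l := Lfun2D (stopped_Lfun2 n) (increment_Lfun2 n).
rewrite ipDl// !ipDr//.
have i0 : ip P (fun w => running n w * X n w) (stopped n) = 0.
  (* The product of the stopped sum and the running coefficient belongs to the past of X_n, so the
     cross term is the expectation of an adapted factor times X_n. Integrability comes from the
     other grouping, as a product of two L^2 functions. *)
  have aV : adapted X n (fun w => stopped n w * running n w).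
    apply: measurable_funM; first exact: adapted_stopped.
    exact: (adapted_running (@adapted_stopped n)).
  rewrite -[RHS](integral_adaptedM X_iid aV).
    by apply: eq_Rintegral => w _; ring.
  rewrite (_ : (fun _ => _) = (fun w => stopped n w * (running n w * X n w))).
    exact: Lfun2_integrableM.
  by apply/funext => w; ring.
rewrite (ipC _ (stopped n) (fun w => running n w * X n w)) i0.
rewrite addr0 add0r lerD// -lee_fin -ipE//; exact: increment_sqr.
Qed.

Let stopped_exit n w k : (k <= n)%N -> lam <= `|gsum c k w| ->
  lam <= `|stopped n w|.
Proof.
move=> kn Sk.
have exit i : lam <= `|stopped i w| -> forall j, (i <= j)%N -> lam <= `|stopped j w|.
  move=> h; elim=> [|j ih]; first by rewrite leqn0 => /eqP <-.
  rewrite leq_eqVlt => /predU1P[<-//|]; rewrite ltnS => /ih{}ih /=.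
  by rewrite ltNge ih /= mul0r addr0.
(* Either some stopped sum of index at most k is already outside, and it stays there up to n, or
   freezing has not begun by time k and the stopped sums coincide with the partial sums, including
   the one that has left the interval. *)
have [/existsP[[i ik] /= hi]|] := boolP [exists i : 'I_k.+1, lam <= `|stopped i w|].
  exact: (exit i hi n (leq_trans (ltnSE ik) kn)).
rewrite negb_exists => /forallP h.
suff E i : (i <= k)%N -> stopped i w = gsum c i w.
  by have := h ord_max; rewrite /= E// Sk.
elim: i => [_|i ih ik]; first by rewrite /gsum big_ord0.
have hi := h (Ordinal (leqW ik : (i < k.+1)%N)).
by rewrite gsumS /= ltNge hi ih// ltnW.
Qed.

Lemma measurable_gsum n : measurable_fun setT (gsum c n).
Proof. exact: (adapted_measurable (@adapted_gsum c n)). Qed.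

Lemma measurable_exit k : measurable [set w | lam <= `|gsum c k w|].
Proof.
rewrite -[X in measurable X]setTI.
have m : measurable_fun setT (fun w => `|gsum c k w|).
  by apply: measurableT_comp => //; exact: measurable_gsum.
have -> : [set w | lam <= `|gsum c k w|] = (fun w => `|gsum c k w|) @^-1` `[lam, +oo[.
  by apply/seteqP; split=> w /=; rewrite in_itv/= andbT.
exact: m.
Qed.

Lemma kolmogorov_maximal M : (forall n, \sum_(i < n) c i ^+ 2 <= M) ->
  (P [set w | exists k, (lam <= `|gsum c k w|)%R] <= (M / lam ^+ 2)%:E)%E.
Proof.
move=> cM.
pose A n := \bigcup_(k in `I_n.+1) [set w | lam <= `|gsum c k w|].
have mA n : measurable (A n) by apply: bigcup_measurable => k _; exact: measurable_exit.
have AE : [set w | exists k, lam <= `|gsum c k w|] = \bigcup_n A n.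
  apply/seteqP; split=> w /=.
    by move=> [k hk]; exists k => //; exists k => /=.
  by move=> [n _ [k _ hk]]; exists k.
have PA n : (P (A n) <= (M / lam ^+ 2)%:E)%E.
  have mY := adapted_measurable (@adapted_stopped n).
  have mY2 : measurable_fun setT (fun w => (stopped n w ^+ 2)%:E).
    by apply/measurable_EFinP; exact: measurable_funX.
  have l20 : 0 < lam ^+ 2 by rewrite exprn_gt0.
  (* Markov's inequality for the squared stopped sum at level lam^2. *)
  have := le_integral_abse P measurableT mY2 l20.
  under [leRHS]eq_integral do rewrite gee0_abs ?lee_fin ?sqr_ge0//.
  rewrite ipE// setTI => h.
  have sub : (P (A n) <= P [set x | ((lam ^+ 2)%:E <= `|(stopped n x ^+ 2)%:E|)%E])%E.
    apply: le_measure; rewrite ?inE//.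
      rewrite -[X in measurable X]setTI.
      apply: emeasurable_fun_c_infty => //; exact: measurableT_comp.
    move=> w [k /= kn hk]; rewrite lee_fin normrX ler_sqr ?nnegrE ?(ltW lam0)//.
    exact: stopped_exit hk.
  have : ((lam ^+ 2)%:E * P (A n) <= (\sum_(i < n) c i ^+ 2)%:E)%E.
    rewrite (le_trans (lee_wpmul2l _ sub)) ?lee_fin ?(ltW l20)//.
    by rewrite (le_trans h)// lee_fin ip_stopped.
  have -> : P (A n) = (fine (P (A n)))%:E by rewrite fineK// fin_num_measure.
  rewrite -EFinM !lee_fin => h'.
  by rewrite ler_pdivlMr// mulrC (le_trans h').
rewrite AE.
have : P (A n) @[n --> \oo] --> P (\bigcup_n A n).
  apply: nondecreasing_cvg_mu => //; first exact: bigcup_measurable.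
  move=> i j ij; apply/subsetPset => w [k /= ki hk]; exists k => //=.
  exact: leq_trans ki _.
move=> h; rewrite -(cvg_lim _ h)//; apply: lime_le.
  by apply/cvg_ex; exists (P (\bigcup_n A n)).
exact: nearW.
Qed.

End maximal_inequality.

End gaussian_sums.

(** * Gaussian series with square-summable coefficients *)

Section gaussian_series.
Context (R : realType) d (T : measurableType d) (P : probability T R).
Context (X : nat -> {RV P >-> R}).
Hypothesis X_iid : iid_std_normal X.
Implicit Types (a b c : nat -> R) (m n : nat) (w : T).

Definition gseries c w : R := limn (fun n => gsum X c n w).

(** Zeroing the first coefficients, instead of shifting indices, makes a difference of partial sums
    again a partial sum over the same variables, so that the maximal inequality applies to it. *)
Definition coef_tail c m i : R := if (m <= i)%N then c i else 0.

Lemma gsum_tail c m n w : (m <= n)%N ->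
  gsum X (coef_tail c m) n w = gsum X c n w - gsum X c m w.
Proof.
elim: n => [|n ih].
  by rewrite leqn0 => /eqP ->; rewrite subrr /gsum big_ord0.
rewrite leq_eqVlt => /predU1P[->|].
  rewrite subrr /gsum big1// => i _.
  by rewrite /coef_tail leqNgt ltn_ord mulr0.
by rewrite ltnS => mn; rewrite !gsumS ih// /coef_tail mn; ring.
Qed.

Lemma sumr_sqr_tail c m n :
  \sum_(i < n) coef_tail c m i ^+ 2 =
  \sum_(i < n) c i ^+ 2 - \sum_(i < minn m n) c i ^+ 2.
Proof.
elim: n => [|n ih]; first by rewrite minn0 !big_ord0 subrr.
rewrite !big_ord_recr/= ih /coef_tail; case: ifPn => mn.
  by rewrite (minn_idPl mn) (minn_idPl (leqW mn)); ring.
rewrite -ltnNge in mn.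
by rewrite (minn_idPr (ltnW mn)) (minn_idPr mn) big_ord_recr/= expr0n/=; ring.
Qed.

(** * Almost sure and mean-square convergence of one series *)

Section convergence.
Context (c : nat -> R) (M : R).
Hypothesis cM : forall n, \sum_(i < n) c i ^+ 2 <= M.

Let s n := \sum_(i < n) c i ^+ 2.
Let r m := limn s - s m.

Let s_nd : nondecreasing_seq s.
Proof.
by apply/nondecreasing_seqP => n; rewrite /s big_ord_recr/= lerDl sqr_ge0.
Qed.

Let s_cvg : cvgn s.
Proof.
apply: nondecreasing_is_cvgn => //.
by exists M => _ [n _ <-]; exact: cM.
Qed.

Let cvg_r : r m @[m --> \oo] --> (0 : R).
Proof. by rewrite -(subrr (limn s)); apply: cvgB => //; exact: cvg_cst. Qed.

Let tail_r m n : \sum_(i < n) coef_tail c m i ^+ 2 <= r m.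
Proof.
rewrite sumr_sqr_tail /r.
have sl k : s k <= limn s by exact: nondecreasing_cvgn_le.
have [mn|nm] := leqP m n; first by rewrite lerB// sl.
by rewrite -/(s n) subrr subr_ge0.
Qed.

Let D m (k : nat) : set T :=
  [set w | exists n, k.+1%:R^-1 <= `|gsum X (coef_tail c m) n w|].

Let measurable_D m k : measurable (D m k).
Proof.
rewrite (_ : D m k = \bigcup_n [set w | k.+1%:R^-1 <= `|gsum X (coef_tail c m) n w|]).
  by apply: bigcup_measurable => n _; exact: measurable_exit.
by apply/seteqP; split=> w /= [n]; [exists n|move=> _; exists n].
Qed.

Let P_D m k : (P (D m k) <= (r m / k.+1%:R^-1 ^+ 2)%:E)%E.
Proof.
have := @kolmogorov_maximal _ _ _ _ _ X_iid (coef_tail c m) k.+1%:R^-1.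
by apply => //; rewrite invr_gt0.
Qed.

(** The negated Cauchy criterion. It is shown to be exactly the set of divergence, so that set is
    measurable, as the measurability of the limit requires. *)
Let N : set T := \bigcup_k \bigcap_m D m k.

Let measurable_N : measurable N.
Proof.
apply: bigcup_measurable => k _; apply: bigcap_measurableType => m _.
exact: measurable_D.
Qed.

(** For fixed k the maximal inequality bounds the intersection by r_m (k + 1)^2 for every m, and the
    remainders r_m of the sum of squares tend to 0. *)
Let P_N : P N = 0.
Proof.
apply/negligibleP => //; apply: negligible_bigcup => k.
apply/negligibleP; first by apply: bigcap_measurableType => m _; exact: measurable_D.
apply/eqP; rewrite eq_le measure_ge0 andbT.
have h : (r m / k.+1%:R^-1 ^+ 2)%:E @[m --> \oo] --> (0%E : \bar R).
  apply: cvg_EFin; first by near=> m.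
  rewrite /comp/= -[X in _ --> X](mul0r ((k.+1%:R^-1 ^+ 2)^-1)).
  exact: cvgMl.
rewrite -(cvg_lim _ h)//; apply: lime_ge; first by apply/cvg_ex; exists 0%E.
apply: nearW => m; apply: le_trans (P_D m k).
apply: le_measure; rewrite ?inE//; last by move=> w; apply.
by apply: bigcap_measurableType => i _; exact: measurable_D.
Unshelve. all: by end_near. Qed.

Let cvg_gsum w : cvgn (fun n => gsum X c n w) <-> ~ N w.
Proof.
split=> [/cvg_ex[l cl] [k _ Nw]|Nw].
  (* Half the tolerance: two partial sums this close to the limit differ by less than 1 / (k + 1).
     An n below m is excluded separately, since the tail sum is then 0. *)
  have e0 : 0 < (k.+1%:R^-1 : R) / 2 by rewrite divr_gt0.
  have /cvgrPdist_lt/(_ _ e0)[m _ hm] := cl.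
  have [n] := Nw m I.
  have [mn|nm] := leqP m n; last first.
    have -> : gsum X (coef_tail c m) n w = 0.
      rewrite /gsum big1// => i _.
      by rewrite /coef_tail leqNgt (ltn_trans (ltn_ord i) nm) mulr0.
    by rewrite normr0 leNgt invr_gt0 ltr0n.
  rewrite gsum_tail//; apply/negP; rewrite -ltNge.
  have h1 := hm m (leqnn m); have h2 := hm n mn.
  rewrite (_ : _ - _ = (l - gsum X c m w) - (l - gsum X c n w)); last by ring.
  by rewrite (le_lt_trans (ler_normB _ _))// (splitr k.+1%:R^-1) ltrD.
apply/cauchy_cvgP/cauchy_exP => e e0.
have [k ke] : exists k, k.+1%:R^-1 < e.
  exists (Num.bound e^-1); rewrite invf_plt ?posrE//.
  have /archi_boundP/lt_le_trans : 0 <= e^-1 by rewrite invr_ge0 ltW.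
  by apply; rewrite ler_nat.
have [m Dm] : exists m, ~ D m k w.
  apply/existsNP => h; apply: Nw; exists k => // m _; exact: h.
exists (gsum X c m w); exists m => // n /= mn.
rewrite /ball/= distrC -gsum_tail// (lt_trans _ ke)//.
by rewrite ltNge; apply/negP => h; apply: Dm; exists n.
Qed.

Lemma gsum_ae_cvg : {ae P, forall w, gsum X c n w @[n --> \oo] --> gseries c w}.
Proof.
exists N; split => // w; apply: contra_notP => Nw.
exact/cvg_gsum.
Qed.

Lemma measurable_gseries : measurable_fun setT (gseries c).
Proof.
(* Modified partial sums that converge everywhere: on the divergence set they are constantly
   [point], the default value taken there by [limn]. *)
pose f n w := (gsum X c n w - point) * \1_(~` N) w + point.
apply: (@measurable_fun_cvg _ _ _ _ f) => [n|w _].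
  apply: measurable_funD => //; apply: measurable_funM.
    by apply: measurable_funB => //; exact: measurable_gsum.
  by apply: measurable_indic; exact: measurableC.
rewrite /f indicE; have [|Nw] := boolP (w \in ~` N).
  rewrite inE => /cvg_gsum cw /=.
  rewrite (_ : (fun _ => _) = (fun n => gsum X c n w)) => [//|].
  by apply/funext => n /=; ring.
have -> : gseries c w = point.
  by apply: dvgP => /cvg_gsum; move: Nw; rewrite notin_setE => /contrapT.
rewrite (_ : (fun _ => _) = cst point); first exact: cvg_cst.
by apply/funext => n /=; rewrite mulr0 add0r.
Qed.

(** Fatou's lemma off the divergence set: the squared distance from the n-th partial sum to the
    limit is at most the lower limit in k of the squared distances to the k-th partial sums, which
    are sums of squares of tail coefficients. The case n = 0 bounds the second moment of the
    limit. *)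
Lemma integral_gseriesB n M' : (forall k, \sum_(i < k) coef_tail c n i ^+ 2 <= M') ->
  (\int[P]_w ((gsum X c n w - gseries c w) ^+ 2)%:E <= M'%:E)%E.
Proof.
move=> cM'.
have mG := measurable_gseries.
have mS k : measurable_fun setT (gsum X c k) by exact: measurable_gsum.
have mSG : measurable_fun setT (fun w => ((gsum X c n w - gseries c w) ^+ 2)%:E).
  by apply/measurable_EFinP/measurable_funX/measurable_funB.
have mf k : measurable_fun setT (fun w => ((gsum X c n w - gsum X c k w) ^+ 2)%:E).
  by apply/measurable_EFinP/measurable_funX/measurable_funB.
rewrite (ge0_negligible_integral measurable_N)//; last first.
  by move=> w _; rewrite lee_fin sqr_ge0.
rewrite setTD.
have mC : measurable (~` N) by exact: measurableC.
pose f k w : \bar R := ((gsum X c n w - gsum X c k w) ^+ 2)%:E.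
have fat : (\int[P]_(w in ~` N) limn_einf (f ^~ w) <=
    limn_einf (fun k => \int[P]_(w in ~` N) f k w))%E.
  apply: fatou => // [k|k w _]; first exact: measurable_funS (mf k).
  by rewrite lee_fin sqr_ge0.
apply: (@le_trans _ _ (\int[P]_(w in ~` N) limn_einf (f ^~ w))%E).
  rewrite le_eqVlt; apply/orP; left; apply/eqP; apply: eq_integral => w.
  rewrite inE => /cvg_gsum cw.
  have h : f k w @[k --> \oo] --> ((gsum X c n w - gseries c w) ^+ 2)%:E.
    apply: cvg_EFin; first by near=> k.
    rewrite /comp/=; apply: (@continuous_cvg _ _ _ _ _ _ (fun x : R => x ^+ 2)).
      exact: exprn_continuous.
    by apply: cvgB => //; exact: cvg_cst.
  by rewrite is_cvg_limn_einfE ?(cvg_lim _ h)//; apply/cvg_ex; eexists; exact: h.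
apply: (le_trans fat).
rewrite limn_einf_lim; apply: lime_le; first exact: is_cvg_einfs.
near=> k.
have nk : (n <= k)%N by near: k; exact: nbhs_infty_ge.
apply: (@le_trans _ _ (\int[P]_(w in ~` N) f k w)%E).
  by apply: ereal_inf_lbound; exists k => /=.
apply: (@le_trans _ _ (\int[P]_w f k w)%E).
  apply: ge0_subset_integral; [exact: mC|exact: measurableT|exact: mf| |by []].
  by move=> w _; rewrite lee_fin sqr_ge0.
rewrite (_ : f k = (fun w => (gsum X (coef_tail c n) k w ^+ 2)%:E)); last first.
  by apply/funext => w; rewrite /f gsum_tail// -sqrrN opprB.
rewrite ipE; last exact: gsum_Lfun2.
by rewrite lee_fin ip_gsum// (le_trans _ (cM' k)).
Unshelve. all: by end_near. Qed.

Lemma integral_gseries_sqr :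
  (\int[P]_w (gseries c w ^+ 2)%:E <= M%:E)%E.
Proof.
have h : (\int[P]_w ((gsum X c 0 w - gseries c w) ^+ 2)%:E <= M%:E)%E.
  by apply: integral_gseriesB => k; rewrite (le_trans _ (cM k)).
rewrite (le_trans _ h)//; under [leRHS]eq_integral => w _.
  rewrite /gsum big_ord0 sub0r sqrrN.
  over.
exact: lexx.
Qed.

Lemma gseries_Lfun2 : gseries c \in Lfun P 2%:E.
Proof.
apply: Lfun2_integral_sqr; first exact: measurable_gseries.
by rewrite (le_lt_trans integral_gseries_sqr)// ltry.
Qed.

Lemma cvg_gsum_L2 :
  ip P (fun w => gsum X c n w - gseries c w) (fun w => gsum X c n w - gseries c w)
    @[n --> \oo] --> (0 : R).
Proof.
apply: (squeeze_cvgr _ (cvg_cst 0) cvg_r); apply: nearW => n; rewrite ip_ge0/=.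
rewrite -lee_fin -ipE; first exact: integral_gseriesB (tail_r n).
by apply: Lfun2B; [exact: gsum_Lfun2|exact: gseries_Lfun2].
Qed.

End convergence.

(** * Linearity up to null sets, and the isometry *)

Section linearity_covariance.
Context (a b : nat -> R) (Ma Mb : R).
Hypothesis aM : forall n, \sum_(i < n) a i ^+ 2 <= Ma.
Hypothesis bM : forall n, \sum_(i < n) b i ^+ 2 <= Mb.

(** Almost surely, the combination is the series with coefficients a_i t - b_i. The identity may
    fail where a series diverges, so it is used only under the integral. The factor t stands for the
    inverse volume of a ball. *)
Lemma ip_gseriesB t M : (forall n, \sum_(i < n) (a i * t - b i) ^+ 2 <= M) ->
  ip P (fun w => gseries a w * t - gseries b w)
       (fun w => gseries a w * t - gseries b w) <= M.
Proof.
move=> cM; pose c i := a i * t - b i.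
have {}cM n : \sum_(i < n) c i ^+ 2 <= M by exact: cM.
have la := gseries_Lfun2 aM; have lb := gseries_Lfun2 bM.
have lab : (fun w => gseries a w * t - gseries b w) \in Lfun P 2%:E.
  apply: Lfun2B => //; rewrite (_ : (fun _ => _) = (fun w => t * gseries a w)).
    exact: Lfun2Z.
  by apply/funext => w; rewrite mulrC.
rewrite -lee_fin -ipE//.
apply: (le_trans _ (@integral_gseries_sqr c M cM)).
rewrite le_eqVlt; apply/orP; left; apply/eqP.
apply: ge0_ae_eq_integral => //.
- by apply/measurable_EFinP/measurable_funX; exact: Lfun2_measurable lab.
- by apply/measurable_EFinP/measurable_funX; exact: measurable_gseries.
- by move=> w _; rewrite lee_fin sqr_ge0.
- by move=> w _; rewrite lee_fin sqr_ge0.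
have ha := gsum_ae_cvg aM; have hb := gsum_ae_cvg bM.
apply: filterS2 ha hb => w ha hb _; congr (_ ^+ 2)%:E.
apply/esym/cvg_lim => //.
rewrite (_ : (fun n => _) = (fun n => gsum X a n w * t - gsum X b n w)).
  by apply: cvgB => //; exact: cvgMl.
apply/funext => n; rewrite /gsum mulr_suml -sumrB; apply: eq_bigr => i _.
by rewrite /c; ring.
Qed.

(** Two limits in succession: with n terms of the first series fixed, the products with k terms of
    the second are constant from k = n on; then n tends to infinity. *)
Lemma cvg_ip_gseries :
  \sum_(i < n) a i * b i @[n --> \oo] --> ip P (gseries a) (gseries b).
Proof.
have la := gseries_Lfun2 aM; have lb := gseries_Lfun2 bM.
have lS c n : gsum X c n \in Lfun P 2%:E by exact: gsum_Lfun2.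
have -> : (fun n => \sum_(i < n) a i * b i) = (fun n => ip P (gsum X a n) (gseries b)).
  apply/funext => n.
  have h : ip P (gsum X a n) (gsum X b k) @[k --> \oo] -->
      ip P (gsum X a n) (gseries b).
    rewrite (ipC _ _ (gseries b)); under eq_fun do rewrite ipC.
    apply: (@cvg_ipl _ _ _ P _ _ _ (fun k => gsum X b k) _ (gsum X a n)) => //.
    exact: cvg_gsum_L2 bM.
  rewrite -(cvg_lim _ h)//; apply/esym/cvg_lim => //.
  apply: cvg_near_cst; near=> k.
  have nk : (n <= k)%N by near: k; exact: nbhs_infty_ge.
  (* Padding with zeros gives both partial sums the same length k, as the finite isometry
     requires. *)
  pose a' i := if (i < n)%N then a i else 0.
  have -> : gsum X a n = gsum X a' k.
    apply/funext => w; rewrite /gsum (big_ord_widen k (fun i => X i w * a i) nk).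
    rewrite big_mkcond; apply: eq_bigr => i _.
    by rewrite /a'; case: ifP => // _; rewrite mulr0.
  rewrite ip_gsum// (big_ord_widen k (fun i => a i * b i) nk) [RHS]big_mkcond.
  by apply: eq_bigr => i _; rewrite /a'; case: ifP => // _; rewrite mul0r.
exact: (cvg_ipl (lS a) la lb (cvg_gsum_L2 aM)).
Unshelve. all: by end_near. Qed.

Lemma integral_gseries : \int[P]_w gseries a w = 0.
Proof.
have l1 : (fun=> 1) \in Lfun P 2%:E by exact: Lfun_cst.
have h := cvg_ipl (gsum_Lfun2 X_iid a) (gseries_Lfun2 aM) l1 (cvg_gsum_L2 aM).
have E : ip P (gsum X a k) (fun=> 1) @[k --> \oo] --> (0 : R).
  rewrite (_ : (fun k => _) = (fun=> 0)); first exact: cvg_cst.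
  apply/funext => k; rewrite -[RHS](integral_gsum X_iid a k).
  by apply: eq_Rintegral => w _; rewrite mulr1.
rewrite -[RHS](cvg_unique _ (h _) E)//.
by apply: eq_Rintegral => w _; rewrite mulr1.
Qed.

End linearity_covariance.

End gaussian_series.

(** * Bessel and Parseval *)

Section orthonormal.
Context d (T : measurableType d) (R : realType) (mu : {measure set T -> \bar R}).
Context (E : nat -> T -> R).
Hypothesis lE : forall i, E i \in Lfun mu 2%:E.
Hypothesis oE : forall i j, ip mu (E i) (E j) = (i == j)%:R.

Definition expansion f n x := \sum_(i < n) ip mu f (E i) * E i x.

Lemma expansion_Lfun2 f n : expansion f n \in Lfun mu 2%:E.
Proof.
by apply: Lfun2_sum (fun i x => ip mu f (E i) * E i x) n _ => i; exact: Lfun2Z.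
Qed.

Lemma ip_expansion f g n : g \in Lfun mu 2%:E ->
  ip mu (expansion f n) g = \sum_(i < n) ip mu f (E i) * ip mu g (E i).
Proof.
move=> lg; rewrite (ip_suml (F := fun i x => ip mu f (E i) * E i x))// => [|i].
  by apply: eq_bigr => i _; rewrite ipZl// (ipC _ (E i)).
exact: Lfun2Z.
Qed.

Lemma ip_expansion_basis f n i : (i < n)%N ->
  ip mu (expansion f n) (E i) = ip mu f (E i).
Proof.
move=> ilen; rewrite ip_expansion// (bigD1 (Ordinal ilen))//= oE eqxx mulr1.
rewrite big1 ?addr0// => j ji; rewrite oE [_ == _]eq_sym.
rewrite (_ : (_ == _) = false) ?mulr0//; apply/negbTE.
by apply: contra ji => /eqP ji; apply/eqP/val_inj.
Qed.

Lemma bessel f n : f \in Lfun mu 2%:E ->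
  \sum_(i < n) ip mu f (E i) ^+ 2 <= ip mu f f.
Proof.
move=> lf; have le := expansion_Lfun2 f n.
have := ip_ge0 mu (fun x => f x - expansion f n x).
rewrite ip_sqrB// (ipC _ f) !ip_expansion//.
rewrite [X in _ + X](_ : _ = \sum_(i < n) ip mu f (E i) ^+ 2); last first.
  by apply: eq_bigr => i _; rewrite ip_expansion_basis.
rewrite [X in _ - 2 * X](_ : _ = \sum_(i < n) ip mu f (E i) ^+ 2); last first.
  by apply: eq_bigr.
by move=> h; rewrite -subr_ge0; apply: le_trans h _; lra.
Qed.

Lemma parseval f g : f \in Lfun mu 2%:E -> g \in Lfun mu 2%:E ->
  ip mu (fun x => f x - expansion f n x) (fun x => f x - expansion f n x)
    @[n --> \oo] --> (0 : R) ->
  \sum_(i < n) ip mu f (E i) * ip mu g (E i) @[n --> \oo] --> ip mu f g.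
Proof.
move=> lf lg h; under eq_fun do rewrite -ip_expansion//.
apply: cvg_ipl => //; first exact: expansion_Lfun2.
under eq_fun => n.
  rewrite (_ : ip mu _ _ =
    ip mu (fun x => f x - expansion f n x) (fun x => f x - expansion f n x)).
  over.
  have le := expansion_Lfun2 f n.
  by rewrite !ip_sqrB// (ipC _ f); ring.
exact: h.
Qed.

End orthonormal.

(** * Euclidean balls *)

Section euclidean_balls.
Context (R : realType) (m : nat).
Local Notation E := ('rV[R]_m).
Local Notation mu := (lebesgue_rV R m).
Implicit Types (x y : E).

Lemma le_enorm x i : `|x ord0 i| <= enorm x.
Proof.
rewrite /enorm -sqrtr_sqr; apply: ler_wsqrtr.
by rewrite (bigD1 i)//= lerDl sumr_ge0// => j _; exact: sqr_ge0.
Qed.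

(** A cube inside the Euclidean ball: m / (m + 1)^2 < 1, and the divisor m + 1 also covers dimension
    0. *)
Lemma enorm_lt x (r : R) : 0 < r -> (forall i, `|x ord0 i| < r / m.+1%:R) ->
  enorm x < r.
Proof.
move=> r0 xr; rewrite /enorm -[ltRHS](@ger0_norm _ r) ?ltW// -sqrtr_sqr.
rewrite ltr_sqrt ?exprn_gt0//.
have m0 : 0 < m.+1%:R :> R by rewrite ltr0n.
apply: (@le_lt_trans _ _ (\sum_(i < m) (r / m.+1%:R) ^+ 2)).
  apply: ler_sum => i _; rewrite -real_normK ?num_real//.
  by rewrite ler_sqr ?nnegrE ?divr_ge0 ?(ltW r0) ?(ltW (xr i)).
have -> : \sum_(i < m) (r / m.+1%:R) ^+ 2 = r ^+ 2 * (m%:R / m.+1%:R ^+ 2).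
  by rewrite sumr_const card_ord -mulr_natr; field.
rewrite -[ltRHS]mulr1 ltr_pM2l ?exprn_gt0//.
rewrite ltr_pdivrMr ?exprn_gt0// mul1r -natrX ltr_nat.
exact: (@leq_pexp2l m.+1 1 2).
Qed.

Lemma nbhs_enorm x (r : R) : 0 < r -> \forall y \near x, enorm (y - x) < r.
Proof.
move=> r0; have m0 : 0 < r / m.+1%:R :> R by rewrite divr_gt0.
apply/nbhs_ballP; exists (r / m.+1%:R) => //= y [_ xy].
apply: enorm_lt => // i; rewrite !mxE.
by have := xy ord0 i; rewrite /ball/= distrC.
Qed.

Lemma eball_nbhs x (U : set E) : open U -> U x ->
  exists2 r : R, 0 < r & forall s, s <= r -> eball x s `<=` U.
Proof.
move=> oU Ux; have /nbhs_ballP[r /= r0 rU] := open_nbhs_nbhs (conj oU Ux).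
exists r => // s sr y; rewrite /eball /= => yx; apply: rU; split => // i j.
rewrite [i]ord1 /ball /= distrC (lt_le_trans _ sr)// (le_lt_trans _ yx)//.
by have := le_enorm (y - x) j; rewrite !mxE.
Qed.

Lemma measurable_eball x (r : R) : measurable (eball x r).
Proof.
have m1 : measurable_fun setT (fun y : E => enorm (y - x)).
  apply: (@measurableT_comp _ _ _ _ _ _ (@Num.sqrt R)).
    apply: continuous_measurable_fun; exact: sqrt_continuous.
  apply: measurable_sum => i; apply: measurable_funX.
  rewrite (_ : (fun _ => _) = (fun y : E => y ord0 i - x ord0 i)).
    by apply: measurable_funB => //; exact: measurable_coord_mx.
  by apply/funext => y; rewrite !mxE.
rewrite -[X in measurable X]setTI.
have -> : eball x r = (fun y => enorm (y - x)) @^-1` `]-oo, r[.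
  by apply/seteqP; split=> y /=; rewrite in_itv/=.
exact: m1.
Qed.

(** The ball contains an open cube of side 2r / (m + 1), whose volume is a product of positive
    lengths. *)
Lemma eball_gt0 x (r : R) : 0 < r -> (0 < mu (eball x r))%E.
Proof.
move=> r0; set q := r / m.+1%:R.
have q0 : 0 < q by rewrite divr_gt0.
pose A i : set R := `]x ord0 i - q, x ord0 i + q[%classic.
have mA i : measurable (A i) by exact: measurable_itv.
apply: (@lt_le_trans _ _ (mu [set y | forall i, A i (y ord0 i)])).
  rewrite lebesgue_rV_box// (eq_bigr (fun=> (q *+ 2)%:E)) => [|i _].
    by rewrite prodEFin lte_fin prodr_gt0// => i _; rewrite pmulrn_lgt0.
  rewrite lebesgue_measure_itv/= lte_fin ltrD2l gtrN//.
  by rewrite -EFinB; congr EFin; rewrite mulr2n; ring.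
apply: le_measure; rewrite ?inE; [exact: measurable_rV_box|exact: measurable_eball|].
move=> y /= Ay; apply: enorm_lt => // i; rewrite !mxE.
by have := Ay i; rewrite /A /= in_itv/= -ltr_distl.
Qed.

End euclidean_balls.

(** * Sections of the kernel *)

Section kernel.
Context (R : realType) (m : nat) (U : set 'rV[R]_m) (K : 'rV[R]_m -> 'rV[R]_m -> R).
Local Notation E := ('rV[R]_m).
Local Notation mu := (lebesgue_rV R m).
Hypothesis oU : open U.
Hypothesis fU : (mu U < +oo)%E.
Hypothesis ucK : unif_continuous_kernel U K.

Let mU : measurable U. Proof. exact: open_measurable_mx. Qed.

Let muU := fine (mu U).

Let muUE : mu U = muU%:E.
Proof. by rewrite /muU fineK// ge0_fin_numE. Qed.

Let muU0 : 0 <= muU. Proof. exact: fine_ge0. Qed.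

Definition ksec (t : E) : E -> R := K t \_ U.

Lemma restrict_in (f : E -> R) x : U x -> (f \_ U) x = f x.
Proof. by move=> Ux; rewrite patchE mem_set. Qed.

Lemma restrict_notin (f : E -> R) x : ~ U x -> (f \_ U) x = 0.
Proof. by move=> Ux; rewrite patchE memNset. Qed.

Lemma L2dotE f g : L2dot U f g = ip mu (f \_ U) (g \_ U).
Proof.
rewrite /L2dot Rintegral_mkcond; apply: eq_Rintegral => x _.
by rewrite !patchE; case: ifP; rewrite ?mul0r.
Qed.

(** The kernel is constrained only on [U], and measurability of its sections there is extracted from
    continuity through superlevel sets. *)
Lemma open_section_gt t (a : R) : U t -> open [set s : E | U s /\ a < K t s].
Proof.
move=> Ut; rewrite openE => s [Us aK].
have e0 : 0 < K t s - a by rewrite subr_gt0.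
have [d d0 hd] := ucK e0.
have hU : \forall s' \near s, U s' by exact: open_nbhs_nbhs.
apply: filterS2 hU (nbhs_enorm s d0) => s' Us' ss'; split => //.
have := hd t s' t s Ut Us' Ut Us.
rewrite subrr {1}/enorm big1 => [|i _]; last by rewrite mxE expr0n.
by rewrite sqrtr0 => /(_ d0 ss'); rewrite ltr_norml => /andP[h _]; lra.
Qed.

Lemma measurable_section t : U t -> measurable_fun U (K t).
Proof.
move=> Ut; apply: (measurability _ (RGenOInfty.measurableE R)).
move=> _ [_ [a ->] <-]; apply: open_measurable_mx.
rewrite (_ : _ `&` _ = [set s : E | U s /\ a < K t s]).
  exact: open_section_gt.
by apply/seteqP; split=> s /=; rewrite in_itv/= andbT.
Qed.

Lemma measurable_ksec t : U t -> measurable_fun setT (ksec t).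
Proof. by move=> Ut; apply/(measurable_restrictT _ mU); exact: measurable_section. Qed.

Lemma bounded_Lfun2 (f : E -> R) (b : R) : measurable_fun setT f ->
  (forall x, U x -> `|f x| <= b) -> (forall x, ~ U x -> f x = 0) ->
  f \in Lfun mu 2%:E /\ ip mu f f <= b ^+ 2 * muU.
Proof.
move=> mf fb f0.
have le : (\int[mu]_x (f x ^+ 2)%:E <= (b ^+ 2 * muU)%:E)%E.
  rewrite EFinM -muUE -integral_cst// [leRHS]integral_mkcond.
  apply: ge0_le_integral => //.
  - by move=> x _; rewrite lee_fin sqr_ge0.
  - by apply/measurable_EFinP; exact: measurable_funX.
  - by apply/(measurable_restrictT _ mU); exact: measurable_cst.
  move=> x _; rewrite patchE; case: ifPn => [|xU].
    rewrite inE => Ux; rewrite lee_fin -real_normK ?num_real// ler_sqr ?nnegrE ?fb//.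
    by rewrite (le_trans _ (fb x Ux)).
  by rewrite f0 ?expr0n//; move: xU; rewrite notin_setE.
have lf : f \in Lfun mu 2%:E.
  by apply: Lfun2_integral_sqr => //; rewrite (le_lt_trans le)// ltry.
by split => //; rewrite -lee_fin -ipE.
Qed.

(** One radius serves all pairs of base points and all s; off [U] both sections vanish. *)
Lemma ksec_close (e : R) : 0 < e -> exists2 r : R, 0 < r &
  forall t u, U t -> U u -> enorm (u - t) < r ->
    forall s, `|ksec u s - ksec t s| <= e.
Proof.
move=> e0; have [r r0 hr] := ucK e0; exists r => // t u Ut Uu ut s.
have [Us|nUs] := pselect (U s); last by rewrite /ksec !restrict_notin// subrr normr0 ltW.
rewrite /ksec !restrict_in// ltW// hr//.
by rewrite subrr /enorm big1 ?sqrtr0// => i _; rewrite mxE expr0n.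
Qed.

Lemma ksecB_Lfun2 (e : R) (t u : E) : U t -> U u ->
  (forall s, `|ksec u s - ksec t s| <= e) ->
  (fun s => ksec u s - ksec t s) \in Lfun mu 2%:E /\
  ip mu (fun s => ksec u s - ksec t s) (fun s => ksec u s - ksec t s) <=
    e ^+ 2 * muU.
Proof.
move=> Ut Uu h; apply: bounded_Lfun2 => //.
- by apply: measurable_funB; exact: measurable_ksec.
- by move=> x nUx; rewrite /ksec !restrict_notin// subrr.
Qed.

(** * A bound on truncated sections, independent of the level *)

Section truncation.
Context (t : E) (C : R) (n : nat).
Hypothesis Ut : U t.
Hypothesis boundK : forall f, L2 U f -> L2 U (integral_operator U K f) /\
  (L2norm U (integral_operator U K f) <= C%:E * L2norm U f)%E.

(** Cutting k_t off by value gives a bounded function, hence one in L^2 of a set of finite measure,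
    that still satisfies k_t g = g^2. *)
Let f (s : E) := if `|K t s| <= n%:R then K t s else 0.
Let g := f \_ U.

Let gE s : g s = if `|ksec t s| <= n%:R then ksec t s else 0.
Proof.
rewrite /g /f; have [Us|nUs] := pselect (U s); first by rewrite /ksec !restrict_in.
by rewrite /ksec !restrict_notin//; case: ifP.
Qed.

Let mg : measurable_fun setT g.
Proof.
rewrite (_ : g = (fun s => if `|ksec t s| <= n%:R then ksec t s else 0)).
  apply: measurable_fun_ifT; [|exact: measurable_ksec|exact: measurable_cst].
  apply: measurable_fun_ler; last exact: measurable_cst.
  by apply: measurableT_comp => //; exact: measurable_ksec.
by apply/funext => s; exact: gE.
Qed.

Let lg : g \in Lfun mu 2%:E.
Proof.
apply: (bounded_Lfun2 mg (b := n%:R) _ _).1 => s Us.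
  by rewrite gE; case: ifP => // _; rewrite normr0.
by rewrite /g restrict_notin.
Qed.

(** Split k_u g into (k_u - k_t) g and k_t g = g^2. *)
Let operator_truncation (u : E) : U u ->
  (fun s => ksec u s - ksec t s) \in Lfun mu 2%:E ->
  integral_operator U K f u = ip mu (fun s => ksec u s - ksec t s) g + ip mu g g.
Proof.
move=> Uu lD; rewrite -ipDl// /integral_operator Rintegral_mkcond.
apply: eq_Rintegral => s _.
have [Us|nUs] := pselect (U s); last by rewrite /g !restrict_notin ?mulr0.
rewrite /g /ksec !restrict_in//= /f; case: ifP => _; ring.
Qed.

(** With q = ||g||^2, the operator bound controls the integral of (K g)^2 over the ball linearly in
    q, while the integrand is q^2 up to a linear error. Dividing by q leaves a bound free of the
    truncation level. *)
Lemma truncation_bound (r : R) : 0 < r -> eball t r `<=` U ->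
  (forall u, U u -> enorm (u - t) < r -> forall s, `|ksec u s - ksec t s| <= 1) ->
  ip mu g g <= 2 * C ^+ 2 / fine (mu (eball t r)) + 2 * muU.
Proof.
move=> r0 rU hr; set B := eball t r; set b := fine (mu B); set q := ip mu g g.
have mB : measurable B by exact: measurable_eball.
have muB_le : (mu B <= mu U)%E by apply: le_measure; rewrite ?inE.
have muBE : mu B = b%:E.
  by rewrite /b fineK// ge0_fin_numE// (le_lt_trans muB_le).
have b0 : 0 < b by rewrite -lte_fin -muBE eball_gt0.
have q0 : 0 <= q := ip_ge0 mu g.
have [lO] := boundK lg.
set h := integral_operator U K f in lO *.
rewrite /L2norm Lnorm2_sqrt// Lnorm2_sqrt// -/g -/q -EFinM lee_fin => normO.
have ipO : ip mu (h \_ U) (h \_ U) <= C ^+ 2 * q.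
  rewrite -(sqr_sqrtr (ip_ge0 mu (h \_ U))) -(sqr_sqrtr q0) -exprMn ler_sqr ?nnegrE ?sqrtr_ge0//.
  by rewrite (le_trans _ normO) ?sqrtr_ge0.
have pointwise u : B u -> q ^+ 2 <= 2 * ((h \_ U) u) ^+ 2 + 2 * (muU * q).
  move=> Bu; have Uu := rU _ Bu.
  have [lD Dle] := ksecB_Lfun2 Ut Uu (hr u Uu Bu).
  rewrite restrict_in// /h operator_truncation// -/q.
  set D := ip mu _ g.
  have : D ^+ 2 <= muU * q.
    rewrite (le_trans (cauchy_schwarz lD lg))// ler_wpM2r//.
    by rewrite (le_trans Dle)// expr1n mul1r.
  (* The identity 2 (D + q)^2 + 2 D^2 - q^2 = (q + 2 D)^2 gives the constants. *)
  move=> hD; have := sqr_ge0 (q + 2 * D); rewrite !expr2 in hD *; nra.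
have int : b * q ^+ 2 <= 2 * (C ^+ 2 * q) + b * (2 * (muU * q)).
  have mO := Lfun2_measurable lO.
  have mO2 (D : set E) : measurable_fun D (fun u => (2 * (h \_ U) u ^+ 2)%:E).
    apply/measurable_EFinP; apply: measurable_funTS.
    by apply: measurable_funM => //; exact: measurable_funX.
  rewrite -lee_fin EFinD.
  have -> : (b * q ^+ 2)%:E = (\int[mu]_(u in B) (cst (q ^+ 2)%:E) u)%E.
    by rewrite mulrC EFinM -muBE; exact/esym/integral_cst.
  apply: (@le_trans _ _ (\int[mu]_(u in B) ((2 * (h \_ U) u ^+ 2)%:E +
      cst (2 * (muU * q))%:E u))%E).
    apply: ge0_le_integral => //.
    - by move=> u _; rewrite lee_fin sqr_ge0.
    - exact: emeasurable_funD.
  have c0 : 0 <= 2 * (muU * q) by rewrite !mulr_ge0.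
  rewrite ge0_integralD//; last first.
    by move=> u _; rewrite lee_fin mulr_ge0// sqr_ge0.
  have -> : (\int[mu]_(u in B) (cst (2 * (muU * q))%:E) u)%E = (b * (2 * (muU * q)))%:E.
    by rewrite (mulrC b) [in RHS]EFinM -muBE; exact: integral_cst.
  rewrite leeD2r//.
  apply: (@le_trans _ _ (\int[mu]_u (2 * (h \_ U) u ^+ 2)%:E)%E).
    apply: ge0_subset_integral; [exact: mB|exact: measurableT|exact: mO2| |by []].
    by move=> u _; rewrite lee_fin mulr_ge0// sqr_ge0.
  under eq_integral do rewrite EFinM.
  rewrite ge0_integralZl_EFin//; first last.
  - by apply/measurable_EFinP; exact: measurable_funX.
  - by move=> u _; rewrite lee_fin sqr_ge0.
  by rewrite ipE// -EFinM lee_fin ler_wpM2l.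
have [->|qn0] := eqVneq q 0.
  apply: addr_ge0; last exact: mulr_ge0.
  by apply: divr_ge0; [apply: mulr_ge0 => //; exact: sqr_ge0|exact: ltW].
have {}q0 : 0 < q by rewrite lt_neqAle eq_sym qn0.
rewrite -(ler_pM2l (mulr_gt0 b0 q0)).
have -> : b * q * (2 * C ^+ 2 / b + 2 * muU) = 2 * (C ^+ 2 * q) + b * (2 * (muU * q)).
  by field; exact: lt0r_neq0.
by rewrite -mulrA -expr2.
Qed.

Lemma truncation_integral :
  (\int[mu]_(s in [set s | (`|ksec t s| <= n%:R)%R]) (ksec t s ^+ 2)%:E =
   (ip mu g g)%:E)%E.
Proof.
rewrite -ipE// [LHS]integral_mkcond; apply: eq_integral => s _.
rewrite patchE gE; case: ifPn; first by rewrite inE/= => ->.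
by rewrite notin_setE/= => /negP/negbTE ->; rewrite expr0n.
Qed.

End truncation.

(** Monotone convergence along the level sets of |k_t|, on which the truncation bound is uniform. *)
Lemma ksec_Lfun2 t : bounded_operator U (integral_operator U K) -> U t ->
  ksec t \in Lfun mu 2%:E.
Proof.
move=> [C boundK] Ut.
have [r1 r10 hr1] := eball_nbhs oU Ut.
have [r2 r20 hr2] := ksec_close (@ltr01 R).
pose r := Num.min r1 r2.
have r0 : 0 < r by rewrite lt_min r10.
have rU : eball t r `<=` U by apply: hr1; rewrite ge_min lexx.
have hr u : U u -> enorm (u - t) < r -> forall s, `|ksec u s - ksec t s| <= 1.
  by move=> Uu; rewrite lt_min => /andP[_ ut]; exact: hr2.
have mk := measurable_ksec Ut.
pose M := 2 * C ^+ 2 / fine (mu (eball t r)) + 2 * muU.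
apply: Lfun2_integral_sqr => //.
pose F (n : nat) := [set s : E | `|ksec t s| <= n%:R].
have FT : \bigcup_n F n = setT.
  apply/seteqP; split => // s _; exists (Num.bound `|ksec t s|) => //.
  by rewrite /F /= ltW// archi_boundP.
have ndF : nondecreasing_seq F.
  move=> i j ij; apply/subsetPset => s; rewrite /F/=.
  by move=> /le_trans; apply; rewrite ler_nat.
have mF n : measurable (F n).
  rewrite -[X in measurable X]setTI.
  have -> : F n = (fun s => `|ksec t s|) @^-1` `]-oo, n%:R].
    by apply/seteqP; split=> y /=; rewrite in_itv/=.
  have mn : measurable_fun setT (fun s => `|ksec t s|) by exact: measurableT_comp.
  exact: mn.
have mk2 : measurable_fun setT (fun s => (ksec t s ^+ 2)%:E).
  by apply/measurable_EFinP; exact: measurable_funX.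
have h : (\int[mu]_(x in F n) (ksec t x ^+ 2)%:E)%E @[n --> \oo] -->
    (\int[mu]_x (ksec t x ^+ 2)%:E)%E.
  rewrite -FT; apply: ge0_nondecreasing_set_cvg_integral => //.
  - by move=> n; exact: measurable_funTS.
  - by move=> n x _; rewrite lee_fin sqr_ge0.
rewrite (@le_lt_trans _ _ M%:E) ?ltry//.
rewrite -(cvg_lim _ h)//; apply: lime_le; first by apply/cvg_ex; eexists; exact: h.
apply: nearW => n; rewrite (truncation_integral n Ut) lee_fin.
exact: truncation_bound.
Qed.

End kernel.

(** * Averages over balls *)

Section ball_averages.
Context (R : realType) (m : nat) (U : set 'rV[R]_m) (K : 'rV[R]_m -> 'rV[R]_m -> R).
Context (e : nat -> 'rV[R]_m -> R).
Local Notation E := ('rV[R]_m).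
Local Notation mu := (lebesgue_rV R m).
Hypothesis oU : open U.
Hypothesis fU : (mu U < +oo)%E.
Hypothesis ucK : unif_continuous_kernel U K.
Hypothesis bK : bounded_operator U (integral_operator U K).
Hypothesis be : orthonormal_basis U e.

Let muU := fine (mu U).
Let ebar i := e i \_ U.
Let kL2 t (Ut : U t) : ksec U K t \in Lfun mu 2%:E := ksec_Lfun2 oU fU ucK bK Ut.

Lemma basis_Lfun2 i : ebar i \in Lfun mu 2%:E.
Proof. by have [+ _ _] := be; exact. Qed.

Lemma basis_orthonormal i j : ip mu (ebar i) (ebar j) = (i == j)%:R.
Proof. by rewrite -L2dotE; have [_ + _] := be; exact. Qed.

Definition point_coef (t : E) (i : nat) : R := ip mu (ksec U K t) (e i \_ U).

(** These are the coefficients of the process at the indicator of the ball, so a ball average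
    unfolds to a [gseries] divided by the volume. *)
Definition ball_coef (t : E) (r : R) (i : nat) : R :=
  L2dot U (\1_(eball t r)) (integral_operator U K (e i)).

Lemma point_coef_bound t n : U t ->
  \sum_(i < n) point_coef t i ^+ 2 <= ip mu (ksec U K t) (ksec U K t).
Proof.
by move=> Ut; exact: (bessel basis_Lfun2 basis_orthonormal n (kL2 Ut)).
Qed.

Lemma cvg_point_coef t u : U t -> U u ->
  \sum_(i < n) point_coef t i * point_coef u i @[n --> \oo] -->
  ip mu (ksec U K t) (ksec U K u).
Proof.
move=> Ut Uu; apply: (parseval basis_Lfun2 (kL2 Ut) (kL2 Uu)).
have lk := kL2 Ut.
have [_ _ /(_ (K t) lk) h] := be.
have l n : (fun x => ksec U K t x - expansion mu ebar (ksec U K t) n x) \in Lfun mu 2%:E.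
  by apply: Lfun2B => //; apply: expansion_Lfun2; exact: basis_Lfun2.
apply/(cvg_ip_Lnorm (F := \oo)); first exact: nearW.
apply: cvg_trans h; apply: near_eq_cvg; apply: nearW => n.
rewrite /L2norm; congr (Lnorm _ _ _); apply/funext => x /=; congr EFin.
have [Ux|nUx] := pselect (U x).
  rewrite /ksec !restrict_in// /expansion; congr (_ - _); apply: eq_bigr => i _.
  by rewrite L2dotE /ebar restrict_in.
rewrite /ksec !restrict_notin// /expansion big1 ?subrr// => i _.
by rewrite /ebar restrict_notin ?mulr0.
Qed.

(** * Coefficients on one small ball *)

Section one_ball.
Context (t : E) (r eps : R).
Hypothesis Ut : U t.
Hypothesis r0 : 0 < r.
Hypothesis rU : eball t r `<=` U.
Hypothesis close : forall u, U u -> enorm (u - t) < r ->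
  forall s, `|ksec U K u s - ksec U K t s| <= eps.

Let B := eball t r.
Let b := fine (mu B).
Let v i := ball_coef t r i * b^-1 - point_coef t i.

Let muBE : mu B = b%:E.
Proof.
rewrite /b fineK// ge0_fin_numE//; apply: le_lt_trans fU.
by apply: le_measure; rewrite ?inE//; [exact: measurable_eball|exact: open_measurable_mx].
Qed.

Lemma ball_measure_gt0 : 0 < fine (mu (eball t r)).
Proof. by rewrite -lte_fin -/B -/b -muBE eball_gt0. Qed.

Let b0 : 0 < b := ball_measure_gt0.

Let indicB u : ~ U u -> \1_B u = 0 :> R.
Proof. by move=> nUu; rewrite indicE memNset// => /rU. Qed.

Let lB : \1_B \in Lfun mu 2%:E.
Proof.
apply: (bounded_Lfun2 oU fU (b := 1) _ _ _).1 => //.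
- by apply: measurable_indic; exact: measurable_eball.
- by move=> x _; rewrite indicE; case: (_ \in _); rewrite ?normr1 ?normr0.
Qed.

Let ipB : ip mu \1_B \1_B = b.
Proof.
apply: EFin_inj; rewrite -ipE// -muBE.
transitivity (mu (B `&` setT)); last by rewrite setIT.
rewrite -integral_indic//; last exact: measurable_eball.
apply: eq_integral => u _; congr EFin; rewrite indicE.
by case: (_ \in _); rewrite ?expr1n ?expr0n.
Qed.

Let O i := integral_operator U K (e i) \_ U.

Let lO i : O i \in Lfun mu 2%:E.
Proof. by have [C /(_ (e i) (basis_Lfun2 i))[]] := bK. Qed.

(** At a point u of the ball this is the i-th coefficient of k_u - k_t, and its integral over the
    ball is the error [v i] times the volume. *)
Let G i u := O i u - point_coef t i * \1_B u.

Let lG i : G i \in Lfun mu 2%:E.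
Proof. by apply: Lfun2B => //; exact: Lfun2Z. Qed.

Let v_ip i : v i * b = ip mu (G i) \1_B.
Proof.
rewrite ipBl// ?Lfun2Z// ipZl// ipB /v mulrBl mulfVK ?gt_eqF//; congr (_ - _).
rewrite /ball_coef L2dotE ipC; congr ip; apply/funext => u.
have [Uu|nUu] := pselect (U u); first by rewrite restrict_in.
by rewrite restrict_notin// indicB.
Qed.

Let G_point u i : B u -> G i u = ip mu (fun s => ksec U K u s - ksec U K t s) (ebar i).
Proof.
move=> Bu; have Uu := rU Bu.
rewrite ipBl//; [|exact: kL2|exact: kL2|exact: basis_Lfun2].
rewrite /G indicE mem_set// mulr1; congr (_ - _).
rewrite /O restrict_in// /integral_operator -[LHS]/(L2dot U (K u) (e i)).
by rewrite L2dotE.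
Qed.

(** With V the sum of the v_i^2, V times the volume is the integral over the ball of the sum of the
    v_i G_i(u). By v_i G_i <= (v_i^2 + G_i^2) / 2 and Bessel for k_u - k_t, the integrand is at most
    (V + D) / 2, whence V <= D. *)
Lemma ball_coef_close n :
  \sum_(i < n) (ball_coef t r i * (fine (mu (eball t r)))^-1 - point_coef t i) ^+ 2
    <= eps ^+ 2 * muU.
Proof.
rewrite -/B -/b -[X in X <= _]/(\sum_(i < n) v i ^+ 2).
set V := \sum_(i < n) v i ^+ 2; set D := eps ^+ 2 * muU.
have lvG : (fun u => \sum_(i < n) v i * G i u) \in Lfun mu 2%:E.
  by apply: (Lfun2_sum (F := fun i u => v i * G i u)) => i; exact: Lfun2Z.
have Vb : V * b = ip mu (fun u => \sum_(i < n) v i * G i u) \1_B.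
  rewrite (ip_suml (F := fun i u => v i * G i u))// => [|i]; last exact: Lfun2Z.
  by rewrite mulr_suml; apply: eq_bigr => i _; rewrite ipZl// -v_ip expr2 mulrA.
have : V * b <= (V + D) / 2 * b.
  rewrite Vb -ipB -ipZl//; apply: le_Rintegral => //.
  - exact: Lfun2_integrableM.
  - by apply: Lfun2_integrableM => //; exact: Lfun2Z.
  move=> u _; have [Bu|nBu] := pselect (B u); last by rewrite indicE memNset// !mulr0.
  rewrite indicE mem_set// !mulr1.
  have Uu := rU Bu.
  have [lD le_D] := ksecB_Lfun2 oU fU ucK Ut Uu (close Uu Bu).
  have bes := bessel basis_Lfun2 basis_orthonormal n lD.
  have : \sum_(i < n) v i * G i u <= (V + \sum_(i < n) G i u ^+ 2) / 2.
    rewrite /V -big_split/= mulr_suml; apply: ler_sum => i _.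
    by have := sqr_ge0 (v i - G i u); rewrite !expr2; lra.
  move=> /le_trans; apply; rewrite ler_wpM2r// lerD2l (le_trans _ le_D)//.
  by apply: le_trans bes; rewrite le_eqVlt; apply/orP; left; apply/eqP;
    apply: eq_bigr => i _; rewrite G_point.
rewrite ler_pM2r//; lra.
Qed.

(** A crude estimate whose purpose is square-summability, so that the series of the ball average
    converges almost surely. *)
Lemma ball_coef_bound n :
  \sum_(i < n) ball_coef t r i ^+ 2 <=
  (2 * (eps ^+ 2 * muU) + 2 * ip mu (ksec U K t) (ksec U K t)) *
  fine (mu (eball t r)) ^+ 2.
Proof.
have h1 := ball_coef_close n; have h2 := point_coef_bound n Ut.
rewrite -/B -/b in h1 *.
apply: (@le_trans _ _ ((2 * (\sum_(i < n) (ball_coef t r i * b^-1 - point_coef t i) ^+ 2)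
    + 2 * \sum_(i < n) point_coef t i ^+ 2) * b ^+ 2)).
  rewrite !mulr_sumr -big_split/= mulr_suml; apply: ler_sum => i _.
  set x := ball_coef t r i; set y := point_coef t i.
  have {1}-> : x = ((x * b^-1 - y) + y) * b by rewrite subrK mulfVK// gt_eqF.
  rewrite exprMn ler_wpM2r ?sqr_ge0//.
  by have := sqr_ge0 ((x * b^-1 - y) - y); rewrite !expr2; lra.
by rewrite ler_wpM2r ?sqr_ge0// lerD// ler_wpM2l.
Qed.

End one_ball.

(** * Local values of the process and their covariance *)

Section process.
Context d (T : measurableType d) (P : probability T R) (X : nat -> {RV P >-> R}).
Hypothesis X_iid : iid_std_normal X.
Let Kt := gaussian_process U X e (integral_operator U K).

Definition point_value t := gseries X (point_coef t).

Let ball_averageE t r : ball_average Kt t r =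
  (fun w => gseries X (ball_coef t r) w * (fine (mu (eball t r)))^-1).
Proof. by []. Qed.

Lemma point_value_Lfun2 t : U t -> point_value t \in Lfun P 2%:E.
Proof.
move=> Ut; apply: (gseries_Lfun2 X_iid (M := ip mu (ksec U K t) (ksec U K t))) => n.
exact: point_coef_bound.
Qed.

Lemma ball_average_close t (del : R) : U t -> 0 < del ->
  exists2 r : R, 0 < r & forall s, 0 < s -> s < r ->
    ball_average Kt t s \in Lfun P 2%:E /\
    ip P (fun w => ball_average Kt t s w - point_value t w)
         (fun w => ball_average Kt t s w - point_value t w) <= del.
Proof.
move=> Ut del0.
have muU0 : 0 <= muU by exact: fine_ge0.
(* Chosen so that eps^2 times the measure of [U] is at most [del]; the added 1 keeps the denominator
   positive. *)
pose eps := Num.sqrt (del / (muU + 1)).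
have q0 : 0 < del / (muU + 1) by rewrite divr_gt0// ltr_wpDl.
have eps0 : 0 < eps by rewrite sqrtr_gt0.
have [r1 r10 h1] := eball_nbhs oU Ut.
have [r2 r20 h2] := ksec_close ucK eps0.
exists (Num.min r1 r2); first by rewrite lt_min r10.
move=> s s0; rewrite lt_min => /andP[sr1 sr2].
have sU : eball t s `<=` U by apply: h1; exact: ltW.
have close u : U u -> enorm (u - t) < s ->
    forall x, `|ksec U K u x - ksec U K t x| <= eps.
  by move=> Uu us; apply: h2 => //; exact: lt_trans sr2.
have bc := ball_coef_bound Ut s0 sU close.
have cc := ball_coef_close Ut s0 sU close.
have pc n := point_coef_bound n Ut.
rewrite ball_averageE; split.
  rewrite (_ : (fun w => _) = (fun w => (fine (mu (eball t s)))^-1 *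
      gseries X (ball_coef t s) w)).
    by apply: Lfun2Z; exact: (gseries_Lfun2 X_iid bc).
  by apply/funext => w; rewrite mulrC.
apply: le_trans (ip_gseriesB X_iid bc pc cc) _.
rewrite sqr_sqrtr ?(ltW q0)// mulrAC ler_pdivrMr ?ltr_wpDl//.
by rewrite ler_pM2l// lerDl.
Qed.

Lemma local_value_point_value t : U t -> local_value P Kt t (point_value t).
Proof.
move=> Ut; have lZ := point_value_Lfun2 Ut.
have near_avg : \forall s \near (0 : R)^'+, ball_average Kt t s \in Lfun P 2%:E.
  have [r r0 h] := ball_average_close Ut ltr01.
  near=> s; apply: (h s _ _).1; near: s; [exact: nbhs_right_gt|exact: nbhs_right_lt].
split => //.
apply/cvg_ip_Lnorm.
  by apply: filterS near_avg => s ls; exact: Lfun2B.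
apply/cvgrPdist_le => del del0.
have [r r0 h] := ball_average_close Ut del0.
near=> s; rewrite sub0r normrN ger0_norm ?ip_ge0//.
apply: (h s _ _).2; near: s; [exact: nbhs_right_gt|exact: nbhs_right_lt].
Unshelve. all: by end_near. Qed.

Lemma local_value_unique t (Z : T -> R) : U t -> local_value P Kt t Z ->
  ip P (fun w => point_value t w - Z w) (fun w => point_value t w - Z w) = 0.
Proof.
move=> Ut [lZ near_avg ZA].
have lp := point_value_Lfun2 Ut.
have [_ _ pA] := local_value_point_value Ut.
have near_sub (Y : T -> R) : Y \in Lfun P 2%:E ->
    \forall s \near (0 : R)^'+, (ball_average Kt t s \- Y) \in Lfun P 2%:E.
  by move=> lY; apply: filterS near_avg => s ls; exact: Lfun2B.
move/(cvg_ip_Lnorm (near_sub _ lZ)) in ZA.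
move/(cvg_ip_Lnorm (near_sub _ lp)) in pA.
apply/eqP; rewrite eq_le ip_ge0 andbT; apply/ler_addgt0Pl => del del0.
(* The differences of one ball average with the two limits each have squared norm at most del / 4,
   and [ip_sqrB_le] doubles both. *)
have del4 : 0 < del / 4 by rewrite divr_gt0.
move/cvgrPdist_le : ZA => /(_ _ del4) nZ.
move/cvgrPdist_le : pA => /(_ _ del4) nA.
near (0 : R)^'+ => s.
have ls : ball_average Kt t s \in Lfun P 2%:E by near: s.
have hZ : `|0 - ip P (ball_average Kt t s \- Z) (ball_average Kt t s \- Z)| <= del / 4.
  by near: s.
have hA : `|0 - ip P (ball_average Kt t s \- point_value t)
    (ball_average Kt t s \- point_value t)| <= del / 4 by near: s.
move: hZ hA; rewrite !sub0r !normrN !ger0_norm ?ip_ge0// => hZ hA.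
have := ip_sqrB_le (Lfun2B ls lZ) (Lfun2B ls lp).
rewrite (_ : (fun x => _ - _) = (fun w => point_value t w - Z w)); last first.
  by apply/funext => w; ring.
by move=> /le_trans; apply; move: hZ hA; lra.
Unshelve. all: by end_near. Qed.

(** Arbitrary local values may be replaced by [point_value] inside scalar products, since the
    difference has norm 0; in particular they are centred. *)
Lemma covariance_local_value u1 u2 (Z1 Z2 : T -> R) : U u1 -> U u2 ->
  local_value P Kt u1 Z1 -> local_value P Kt u2 Z2 ->
  covariance P Z1 Z2 = (\int[mu]_(t in U) (K u1 t * K u2 t)%:E)%E.
Proof.
move=> Uu1 Uu2 lv1 lv2.
have [lZ1 _ _] := lv1; have [lZ2 _ _] := lv2.
have lp1 := point_value_Lfun2 Uu1; have lp2 := point_value_Lfun2 Uu2.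
have ipZ t Z (Y : T -> R) : U t -> local_value P Kt t Z -> Y \in Lfun P 2%:E ->
    ip P Z Y = ip P (point_value t) Y.
  move=> Ut lv lY; have [lZ _ _] := lv; have lp := point_value_Lfun2 Ut.
  apply/esym/eqP; rewrite -subr_eq0 -ipBl//; apply/eqP.
  by apply: ip_null => //; [exact: Lfun2B|exact: local_value_unique].
have l1 : (fun=> 1) \in Lfun P 2%:E by exact: Lfun_cst.
have EZ t Z : U t -> local_value P Kt t Z -> \int[P]_w Z w = 0.
  move=> Ut lv; transitivity (ip P Z (fun=> 1)).
    by apply: eq_Rintegral => w _; rewrite mulr1.
  rewrite (ipZ t)// -[RHS](integral_gseries X_iid (fun n => point_coef_bound n Ut)).
  by apply: eq_Rintegral => w _; rewrite mulr1.
have L1 (Z : T -> R) : Z \in Lfun P 2%:E -> Z \in Lfun P 1.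
  by move=> lZ; apply: Lfun_subset12 => //; rewrite fin_num_measure.
have Efin (Z : T -> R) : Z \in Lfun P 2%:E -> 'E_P[Z]%E = (\int[P]_w Z w)%:E.
  move=> lZ; rewrite unlock /Rintegral fineK//.
  by apply: integrable_fin_num => //; exact/Lfun1_integrable/L1.
rewrite covarianceE ?Lfun2_mul_Lfun1 ?L1// (Efin Z1)// (Efin Z2)// (EZ u1 Z1)// mul0e sube0.
transitivity (ip P Z1 Z2)%:E.
  rewrite unlock /ip /Rintegral fineK//.
  by apply: integrable_fin_num => //; exact: Lfun2_integrableM.
rewrite (ipZ u1)// ipC (ipZ u2)// ipC.
have pc1 n := point_coef_bound n Uu1; have pc2 n := point_coef_bound n Uu2.
have -> : ip P (point_value u1) (point_value u2) = ip mu (ksec U K u1) (ksec U K u2).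
  (* Both sides are limits of the same sums of products of coefficients, by the isometry on one side
     and by Parseval on the other. *)
  exact: (cvg_unique _ (cvg_ip_gseries X_iid pc1 pc2) (cvg_point_coef Uu1 Uu2)).
rewrite /ip /Rintegral fineK; last first.
  by apply: integrable_fin_num => //; apply: Lfun2_integrableM; exact: kL2.
rewrite [RHS]integral_mkcond; apply: eq_integral => s _.
by rewrite /ksec !patchE; case: ifP; rewrite ?mul0r.
Qed.

End process.

End ball_averages.

Theorem proposition11 (R : realType) (m : nat) (U : set 'rV[R]_m)
    (K : 'rV[R]_m -> 'rV[R]_m -> R)
    (d : measure_display) (T : measurableType d) (P : probability T R)
    (X : nat -> {RV P >-> R}) (e : nat -> 'rV[R]_m -> R) :
  open U -> U !=set0 -> (lebesgue_rV R m U < +oo)%E ->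
  bounded_integral_operator U K -> unif_continuous_kernel U K ->
  iid_std_normal X -> orthonormal_basis U e ->
  let Kt := gaussian_process U X e (integral_operator U K) in
  (forall t0, U t0 -> locally_continuous P Kt t0) /\
  (forall u1 u2 (Z1 Z2 : T -> R), U u1 -> U u2 ->
     local_value P Kt u1 Z1 -> local_value P Kt u2 Z2 ->
     covariance P Z1 Z2 =
     (\int[lebesgue_rV R m]_(t in U) (K u1 t * K u2 t)%:E)%E).
Proof.
move=> oU _ fU [_ bK] ucK X_iid be Kt; split.
  move=> t0 Ut0; exists (point_value U K e X t0).
  exact: local_value_point_value.
by move=> u1 u2 Z1 Z2; exact: covariance_local_value.
Qed.
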